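(* Suppose $n\ge4$. If $n$ is even, set $m:=\frac n2+1$ and $$\psi\colon\Sigma_{(n-1)}\to\Sigma_{(n)},\qquad \sigma\mapsto\operatorname{ins}_{m,p}(\sigma),$$ where $p$ is the element of $[n-1]$ with $\sigma^{p-1}(1)=\min\{\sigma^{-1}(\tfrac n2),\tfrac n2\}$. If $n$ is odd, set $m:=\frac{n+1}2$ and $$\psi\colon\Sigma_{(n-1)}\times\{0,1,2\}\to\Sigma_{(n)},\qquad(\sigma,q)\mapsto\operatorname{ins}_{m,p+q}(\sigma),$$ where $p$ is the element of $[n-3]$ with $\sigma^{p-1}(1)\notin\{m-1,m\}$ and $\sigma^p(1)\in\{m-1,m\}$. Then $\psi$ is a bijection.
   Context: $[a,b]=\{c\in\mathbb Z\mid a\le c\le b\}$ and $[a]=[1,a]$. $\mathfrak S_n$ is the symmetric group on $[n]$ (products are compositions of functions), with Coxeter generators $s_i=(i,i+1)$ and Coxeter length function $\ell$ (number of inversions). Relation $\approx$: write $w\overset{s_i}{\to}w'$ if $w'=s_iws_i$ and $\ell(w')\le\ell(w)$. Let $\to$ be the reflexive and transitive closure of the union of the relations $\overset{s_i}{\to}$, $1\le i\le n-1$. Write $w\approx w'$ if $w\to w'$ and $w'\to w$; this is an equivalence relation on $\mathfrak S_n$. Let $(x_1,\dots,x_n)$ be the list with $x_{2i-1}=i$ and $x_{2i}=n-i+1$. The element in stair form $\sigma_{(n)}$ is the $n$-cycle $(x_1,x_2,\dots,x_n)\in\mathfrak S_n$, and $\Sigma_{(n)}\subseteq\mathfrak S_n$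 is the $\approx$-equivalence class of $\sigma_{(n)}$. (All elements of $\Sigma_{(n)}$ are $n$-cycles.) Insertion operator: let $\sigma\in\mathfrak S_N$ be an $N$-cycle, $k\in[2,N+1]$ and $p\in[N]$. For $r=0,\dots,N-1$ put $\varepsilon_r=0$ if $\sigma^r(1)<k$ and $\varepsilon_r=1$ if $\sigma^r(1)\ge k$. Then $\operatorname{ins}_{k,p}(\sigma)$ is the $(N+1)$-cycle of $\mathfrak S_{N+1}$ given, for $r=0,\dots,N$, by $$\operatorname{ins}_{k,p}(\sigma)^r(1)=\begin{cases}\sigma^r(1)+\varepsilon_r&\text{if }r<p,\\ k&\text{if }r=p,\\ \sigma^{r-1}(1)+\varepsilon_{r-1}&\text{if }r>p.\end{cases}$$ That is, writing $\sigma$ in cycle notation starting with $1$, add $1$ to each entry $\ge k$ and then insert $k$ behind the $p$th entry. *)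

(* Defs.v *)
From mathcomp Require Import all_boot all_order all_fingroup.
From mathcomp Require Import zify.

Set Implicit Arguments.
Unset Strict Implicit.
Unset Printing Implicit Defensive.

(* The set [n] = {1, ..., n} is represented by 'I_n, the integer a being the
   ordinal of value a - 1.  Positions, exponents and the integers k, m, p, n
   keep their values. *)

Definition pt (N a : nat) : 'I_N.+1 := inord a.-1.

(* The cycle (c_1, ..., c_r); it is the identity when c has a repetition. *)
Definition cycle_perm (T : finType) (c : seq T) : {perm T} :=
  insubd (1%g : {perm T}) [ffun x => next c x].

Lemma cycle_permE (T : finType) (c : seq T) :
  uniq c -> forall x, cycle_perm c x = next c x.
Proof.
move=> Uc x; rewrite /cycle_perm.
have inj_c : injectiveb [ffun y => next c y].
  apply/injectiveP=> y z; rewrite !ffunE; exact: (can_inj (prev_next Uc)).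
by rewrite -pvalE val_insubd inj_c ffunE.
Qed.

Section Classes.

Variable n : nat.
Implicit Types w : 'S_n.

Definition cox_length w : nat :=
  #|[set ij : 'I_n * 'I_n | (ij.1 < ij.2) && (w ij.2 < w ij.1)]|.

(* The product of 'S_n composes from left to right, but s * w * s is the same
   element for both conventions. *)
Definition cox_step : rel 'S_n := fun w w' =>
  [exists i : 'I_n, exists j : 'I_n,
    [&& j == i.+1 :> nat,
        w' == (tperm i j * w * tperm i j)%g
      & cox_length w' <= cox_length w]].

Definition cox_approx : rel 'S_n := fun w w' =>
  connect cox_step w w' && connect cox_step w' w.

Fact stair_entry_subproof (j : 'I_n) :
  (if odd j then n - j./2.+1 else j./2) < n.
Proof.
have n_gt0 : 0 < n by apply: leq_ltn_trans (ltn_ord j).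
case: ifP => _; first by rewrite ltn_subrL.
by apply: leq_ltn_trans (ltn_ord j); rewrite -[X in _ <= X]odd_double_half
  -addnn addnA leq_addl.
Qed.

(* With j = 2i - 2 this is x_(2i-1) = i, and with j = 2i - 1 it is
   x_(2i) = n - i + 1, both lowered by 1. *)
Definition stair_entry (j : 'I_n) : 'I_n := Ordinal (stair_entry_subproof j).

Definition stair : 'S_n := cycle_perm [seq stair_entry j | j <- enum 'I_n].

Definition Sigma : {set 'S_n} := [set w | cox_approx stair w].

Lemma stair_entry_inj : injective stair_entry.
Proof.
have half_lt (j : 'I_n) : j./2 + j./2 <= j.
  by rewrite addnn -[X in _ <= X]odd_double_half leq_addl.
move=> i j /(congr1 val) /= eq_ij; apply: val_inj => /=.
have [li lj] := (ltn_ord i, ltn_ord j).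
have ei := odd_double_half i; have ej := odd_double_half j.
have [hi hj] := (half_lt i, half_lt j).
move: eq_ij ei ej; rewrite -!addnn; case: (odd i); case: (odd j) => /=; lia.
Qed.

Lemma stair_uniq : uniq [seq stair_entry j | j <- enum 'I_n].
Proof. by rewrite (map_inj_uniq stair_entry_inj) enum_uniq. Qed.

End Classes.

(* lift (pt N.+1 k) adds 1 to the entries that are at least k. *)
Definition ins_entry (N k p : nat) (s : 'S_N.+1) (r : nat) : 'I_N.+2 :=
  if r < p then lift (pt N.+1 k) ((s ^+ r)%g (pt N 1))
  else if r == p then pt N.+1 k
  else lift (pt N.+1 k) ((s ^+ r.-1)%g (pt N 1)).

Definition ins (N k p : nat) (s : 'S_N.+1) : 'S_N.+2 :=
  cycle_perm (mkseq (ins_entry k p s) N.+2).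

Lemma insX (N k p : nat) (s : 'S_N.+1) :
    uniq (mkseq (fun r => (s ^+ r)%g (pt N 1)) N.+1) ->
    2 <= k <= N.+2 -> 1 <= p <= N.+1 ->
  forall r, r <= N.+1 -> (ins k p s ^+ r)%g (pt N.+1 1) = ins_entry k p s r.
Proof.
move=> Us /andP[k_gt1 k_le] /andP[p_gt0 p_le].
have s_inj a b : a <= N -> b <= N ->
    (s ^+ a)%g (pt N 1) = (s ^+ b)%g (pt N 1) -> a = b.
  move=> aN bN; exact: (mkseq_uniqP _ _ Us a b).
have Uc : uniq (mkseq (ins_entry k p s) N.+2).
  apply/mkseq_uniqP=> a b; rewrite !inE /ins_entry => a_lt b_lt.
  case: (ltngtP a p) => a_p; case: (ltngtP b p) => b_p;
    try (by move/lift_inj/s_inj; lia); try (by move=> _; lia);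
    by move/eqP; rewrite ?(negPf (neq_lift _ _)) // eq_sym
      (negPf (neq_lift _ _)).
have entry0 : ins_entry k p s 0 = pt N.+1 1.
  rewrite /ins_entry p_gt0 expg0 perm1; apply: val_inj => /=.
  rewrite /pt /bump !inordK //; lia.
elim=> [|r IHr] r_le; first by rewrite expg0 perm1 entry0.
rewrite expgSr permM IHr 1?ltnW // cycle_permE // next_nth.
have entry_r : nth (pt N.+1 1) (mkseq (ins_entry k p s) N.+2) r
    = ins_entry k p s r by rewrite nth_mkseq // ltnW.
have r_sz : r < size (mkseq (ins_entry k p s) N.+2) by rewrite size_mkseq ltnW.
rewrite -entry_r mem_nth // index_uniq //.
rewrite /mkseq -[iota 0 _]/(0 :: iota 1 N.+1) map_cons.
by rewrite (nth_map 0) ?size_iota // nth_iota.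
Qed.

(* The least element of [a, b] satisfying P, or 0 if there is none. *)
Definition the_in (a b : nat) (P : pred nat) : nat :=
  head 0 [seq p <- iota a (b.+1 - a) | P p].

(* Here and below n = N.+2, so that s is a permutation of [n - 1]. *)
Definition even_pos (N : nat) (s : 'S_N.+1) (p : nat) : bool :=
  let h := pt N N.+2./2 in
  (s ^+ p.-1)%g (pt N 1) == minn ((s^-1)%g h) h :> nat.

Definition psi_even (N : nat) (s : 'S_N.+1) : 'S_N.+2 :=
  ins N.+2./2.+1 (the_in 1 N.+1 (even_pos s)) s.

Definition odd_pos (N : nat) (s : 'S_N.+1) (p : nat) : bool :=
  let m := N.+3./2 in
  ((s ^+ p.-1)%g (pt N 1) \notin [:: pt N m.-1; pt N m])
  && ((s ^+ p)%g (pt N 1) \in [:: pt N m.-1; pt N m]).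

Definition psi_odd (N : nat) (sq : 'S_N.+1 * 'I_3) : 'S_N.+2 :=
  ins N.+3./2 (the_in 1 N.-1 (odd_pos sq.1) + sq.2) sq.1.

Definition bijective_from_to (aT rT : finType) (A : {set aT}) (B : {set rT})
    (f : aT -> rT) : Prop :=
  {in A &, injective f} /\ f @: A = B.

(* Main.v *)
Require Import Defs.
From mathcomp Require Import all_boot all_order all_fingroup.
From mathcomp Require Import zify.

Set Implicit Arguments.
Unset Strict Implicit.
Unset Printing Implicit Defensive.

(* Write n = c + h with c <= h <= c + 1.  An element of Sigma_n is an n-cycle in
   which small and large letters alternate and in which, for every j, the j
   innermost pairs {c - 1 - i, h + i} (together with the middle letter c when n
   is odd) form a contiguous arc.  Such cycles are the words built outwards from
   the core by adding at each level one pair: both letters on the left of the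
   arc, both on the right, or one on each side, the order being forced by the
   alternation.

   A conjugation by a simple transposition (x, x + 1) preserves the length
   exactly when the successors and the predecessors of x and x + 1 are ordered
   in opposite ways.  For two letters of consecutive levels this happens exactly
   when their exchange gives another such word, so the set of these cycles is
   closed under the length-preserving steps; since every word can be moved to
   the one that always adds on both sides, it is a single class.

   Passing from n - 1 to n changes only the core: the middle letter is replaced
   by the innermost pair, or the middle letter is put before, inside or behind
   the innermost pair. *)

(** * Coxeter length under conjugation by a simple transposition *)

(** Exchanging the neighbouring positions i and j carries the inversions of [s] to inversions of the
    product; the only inversion missed is the pair (i, j) itself. *)
Lemma cox_length_mull n (s : 'S_n) (i j : 'I_n) :
  j = i.+1 :> nat -> s i < s j ->
  cox_length (tperm i j * s)%g = (cox_length s).+1.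
Proof.
move=> ij sij; rewrite /cox_length.
set A := [set _ | _]; set B := [set _ | _].
pose f (p : 'I_n * 'I_n) := (tperm i j p.1, tperm i j p.2).
have f_inj : injective f by move=> [a b] [a' b'] [] /perm_inj-> /perm_inj->.
have ne_ij : i != j by rewrite -val_eqE /= ij; lia.
suff -> : A = (i, j) |: f @: B.
  rewrite cardsU1 (card_imset _ f_inj) -[in RHS]add1n.
  suff -> : (i, j) \notin f @: B by [].
  apply/negP => /imsetP[[a b]]; rewrite inE /= => /andP[ab _] [ia jb].
  have ea : a = j by apply: (@perm_inj _ (tperm i j)); rewrite -ia tpermR.
  have eb : b = i by apply: (@perm_inj _ (tperm i j)); rewrite -jb tpermL.
  by move: ab; rewrite ea eb; lia.
apply/setP => -[a b]; rewrite !inE /= !permM xpair_eqE.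
have ff : f (f (a, b)) = (a, b) by rewrite /f /= !tpermK.
rewrite -[X in X \in f @: B]ff (mem_imset _ _ f_inj).
rewrite inE /= -!val_eqE /=.
have sji : (s j < s i) = false by lia.
case: (tpermP i j a) => [->|->|/eqP + /eqP];
  case: (tpermP i j b) => [->|->|/eqP + /eqP];
  rewrite -?val_eqE /= ?ltnn ?eqxx ?andbF ?orbF ?sij ?sji ?andbF ?andbT ?orbF
    //=; lia.
Qed.

Lemma cox_lengthV n (s : 'S_n) : cox_length s^-1 = cox_length s.
Proof.
rewrite /cox_length.
pose f (p : 'I_n * 'I_n) := (s p.2, s p.1).
have f_inj : injective f by move=> [a b] [a' b'] [] /perm_inj-> /perm_inj->.
rewrite -[RHS](card_imset _ f_inj); apply: eq_card => -[a b].
rewrite -[(a, b)](_ : f (s^-1 b, s^-1 a)%g = _) ?mem_imset //; last first.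
  by rewrite /f /= !permKV.
by rewrite /f !inE /= !permKV andbC.
Qed.

Section Conjugation.

Variable n : nat.
Implicit Types s : 'S_n.

Lemma cox_length_mull_gt s (i j : 'I_n) :
  j = i.+1 :> nat -> s j < s i ->
  (cox_length (tperm i j * s)%g).+1 = cox_length s.
Proof.
move=> ij sji; rewrite -(@cox_length_mull _ (tperm i j * s)%g i j) //.
  by rewrite mulgA tperm2 mul1g.
by rewrite !permM tpermL tpermR.
Qed.

Lemma cox_length_mulr s (i j : 'I_n) :
  j = i.+1 :> nat -> (s^-1)%g i < (s^-1)%g j ->
  cox_length (s * tperm i j)%g = (cox_length s).+1.
Proof.
move=> ij sij; rewrite -cox_lengthV invMg tpermV cox_length_mull //.
by rewrite cox_lengthV.
Qed.

Lemma cox_length_mulr_gt s (i j : 'I_n) :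
  j = i.+1 :> nat -> (s^-1)%g j < (s^-1)%g i ->
  (cox_length (s * tperm i j)%g).+1 = cox_length s.
Proof.
move=> ij sij; rewrite -cox_lengthV invMg tpermV cox_length_mull_gt //.
by rewrite cox_lengthV.
Qed.

Definition conflict s (i j : 'I_n) : bool :=
  (s i < s j) != ((s^-1)%g i < (s^-1)%g j).

(* Left and right multiplication by the transposition change the length by one
   each, and the two changes cancel exactly when there is a conflict. *)
Lemma cox_length_conj s (i j : 'I_n) : j = i.+1 :> nat ->
  let s' := (tperm i j * s * tperm i j)%g in
  s' = s \/ (cox_length s' == cox_length s) = conflict s i j.
Proof.
move=> ij /=; set t := tperm i j.
have ne_ij : i != j by rewrite -val_eqE /= ij; lia.
(* If [s] exchanges i and j, or fixes both, it commutes with the transposition and the conjugate is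
   [s] itself. *)
have [[e1 e2]|ne1] := altP (@andP ((s^-1)%g i == j) ((s^-1)%g j == i)).
- left; apply/permP => x; rewrite !permM /t.
  have sj : s j = i by rewrite -(eqP e1) permKV.
  have si : s i = j by rewrite -(eqP e2) permKV.
  case: (tpermP i j x) => [->|->|xi xj]; rewrite ?sj ?si ?tpermL ?tpermR //.
  by rewrite tpermD //; [rewrite -sj|rewrite -si];
    rewrite (inj_eq perm_inj) eq_sym; apply/eqP.
- have [[e3 e4]|ne2] := altP (@andP ((s^-1)%g i == i) ((s^-1)%g j == j)).
    left; apply/permP => x; rewrite !permM /t.
    have si : s i = i by rewrite -{1}(eqP e3) permKV.
    have sj : s j = j by rewrite -{1}(eqP e4) permKV.
    case: (tpermP i j x) => [->|->|xi xj]; rewrite ?sj ?si ?tpermL ?tpermR //.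
    by rewrite tpermD //; [rewrite -si|rewrite -sj];
      rewrite (inj_eq perm_inj) eq_sym; apply/eqP.
  right.
  have tV x : ((t * s)^-1)%g x = t ((s^-1)%g x) by rewrite invMg permM tpermV.
  (* The transposition of the neighbours i and j reverses the order of two values only if these are
     i and j themselves, which [ne1] and [ne2] exclude. *)
  have keep : (((t * s)^-1)%g i < ((t * s)^-1)%g j)
            = ((s^-1)%g i < (s^-1)%g j).
    rewrite !tV /t; move: ne1 ne2.
    have : (s^-1)%g i != (s^-1)%g j by rewrite (inj_eq perm_inj).
    case: (tpermP i j ((s^-1)%g i)) => [->|->|/eqP + /eqP];
    case: (tpermP i j ((s^-1)%g j)) => [->|->|/eqP + /eqP];
    rewrite -!val_eqE /= ?eqxx /=; lia.
  have ne3 : s i != s j by rewrite (inj_eq perm_inj).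
  have ne4 : (s^-1)%g i != (s^-1)%g j by rewrite (inj_eq perm_inj).
  rewrite /conflict.
  have [lt1|gt1] : s i < s j \/ s j < s i by move: ne3; rewrite -val_eqE /=;
    lia.
    have L1 := cox_length_mull ij lt1; rewrite -/t in L1.
    have [lt2|gt2] : (s^-1)%g i < (s^-1)%g j \/ (s^-1)%g j < (s^-1)%g i.
    - by move: ne4; rewrite -val_eqE /=; lia.
    - have L2 := @cox_length_mulr (t * s)%g _ _ ij; rewrite keep in L2.
    - by move: (L2 lt2); rewrite -/t lt1 lt2 L1 => ->; apply/negbTE/eqP; lia.
    - have L2 := @cox_length_mulr_gt (t * s)%g _ _ ij.
      have gt3 : ((t * s)^-1)%g j < ((t * s)^-1)%g i.
        have : ((t * s)^-1)%g i != ((t * s)^-1)%g j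
          by rewrite (inj_eq perm_inj).
        by rewrite -val_eqE /=; lia.
      have -> : ((s^-1)%g i < (s^-1)%g j) = false by apply/negbTE;
        rewrite -leqNgt ltnW.
      by move: (L2 gt3); rewrite -/t lt1 L1 => -[->]; rewrite eqxx.
  have -> : (s i < s j) = false by apply/negbTE; rewrite -leqNgt ltnW.
  have L1 := cox_length_mull_gt ij gt1; rewrite -/t in L1.
  have [lt2|gt2] : (s^-1)%g i < (s^-1)%g j \/ (s^-1)%g j < (s^-1)%g i.
  - by move: ne4; rewrite -val_eqE /=; lia.
  - have L2 := @cox_length_mulr (t * s)%g _ _ ij; rewrite keep in L2.
    by move: (L2 lt2); rewrite -/t lt2 -L1 => ->; rewrite eqxx.
  - have L2 := @cox_length_mulr_gt (t * s)%g _ _ ij.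
    have gt3 : ((t * s)^-1)%g j < ((t * s)^-1)%g i.
      have : ((t * s)^-1)%g i != ((t * s)^-1)%g j by rewrite (inj_eq perm_inj).
      by rewrite -val_eqE /=; lia.
    have -> : ((s^-1)%g i < (s^-1)%g j) = false by apply/negbTE;
      rewrite -leqNgt ltnW.
    by move: (L2 gt3); rewrite -/t -L1 => <-;
      rewrite -addn2 -[X in X == _]addn0 eqn_add2l.
Qed.

End Conjugation.

(** * Permutations acting on natural numbers, and their cyclic words *)

Definition swap (x y z : nat) : nat :=
  if z == x then y else if z == y then x else z.

Lemma swapC x y : swap x y =1 swap y x.
Proof. by rewrite /swap => z; do 2!case: eqP => // ->. Qed.

Lemma swapl x y : swap x y x = y.
Proof. by rewrite /swap eqxx. Qed.

Lemma swapr x y : swap x y y = x.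
Proof. by rewrite swapC swapl. Qed.

Lemma swapN x y z : z <> x -> z <> y -> swap x y z = z.
Proof. by rewrite /swap => /eqP/negPf-> /eqP/negPf->. Qed.

Lemma map_swapN x y w : x \notin w -> y \notin w -> map (swap x y) w = w.
Proof.
move=> xw yw; rewrite -[RHS]map_id; apply/eq_in_map => z zw.
by apply: swapN => ez; [move: xw|move: yw]; rewrite -ez zw.
Qed.

Section Action.

Variable N : nat.
Implicit Type s : 'S_N.+1.

(** With natural numbers as letters, cycles are plain sequences and comparisons are linear
    arithmetic. The action is faithful only below [N.+1], since [inord] sends larger numbers to 0;
    hence the bounds on letters below. *)
Definition actn s (x : nat) : nat := s (inord x).

Definition conjp s (x y : nat) : 'S_N.+1 :=
  (tperm (inord x) (inord y) * s * tperm (inord x) (inord y))%g.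

Lemma actn_lt s x : actn s x < N.+1.
Proof. exact: ltn_ord. Qed.

Lemma actnK s x : x < N.+1 -> actn s^-1 (actn s x) = x.
Proof. by move=> xN; rewrite /actn inord_val permK inordK. Qed.

Lemma actn_inj s x y : x < N.+1 -> y < N.+1 -> actn s x = actn s y -> x = y.
Proof. by move=> xN yN e; rewrite -(actnK s xN) e actnK. Qed.

Lemma actnX s k x : x < N.+1 -> iter k (actn s) x = (s ^+ k)%g (inord x).
Proof.
move=> xN; elim: k => [|k IH] /=; first by rewrite expg0 perm1 inordK.
by rewrite IH /actn inord_val expgSr permM.
Qed.

Lemma tperm_swap x y z : x < N.+1 -> y < N.+1 -> z < N.+1 ->
  tperm (inord x) (inord y) (inord z) = inord (swap x y z) :> 'I_N.+1.
Proof.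
move=> xN yN zN; rewrite /swap.
case: eqP => [->|zx]; first by rewrite tpermL.
case: eqP => [->|zy]; first by rewrite tpermR.
by rewrite tpermD // -val_eqE /= !inordK // eq_sym; apply/eqP.
Qed.

Lemma actn_conjp s x y z : x < N.+1 -> y < N.+1 -> z < N.+1 ->
  actn (conjp s x y) (swap x y z) = swap x y (actn s z).
Proof.
move=> xN yN zN; rewrite /actn /conjp !permM -tperm_swap // tpermK.
rewrite -[X in tperm _ _ X]inord_val tperm_swap //.
by rewrite inordK // /swap; do 2?case: ifP.
Qed.

Lemma fcycle_conjp s x y w : x < N.+1 -> y < N.+1 -> all (ltn^~ N.+1) w ->
  fcycle (actn s) w -> fcycle (actn (conjp s x y)) (map (swap x y) w).
Proof.
move=> xN yN; case: w => //= z w /andP[zN wN].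
rewrite -map_rcons.
have : all (ltn^~ N.+1) (rcons w z) by rewrite all_rcons /= zN.
move: (rcons w z) => v; elim: v z zN {w wN} =>
  //= u w IH z zN /andP[uN wN] /andP[/eqP zu uw].
by rewrite actn_conjp // zu eqxx IH.
Qed.

Lemma fcycle_actn_inj s1 s2 w : perm_eq w (iota 0 N.+1) ->
  fcycle (actn s1) w -> fcycle (actn s2) w -> s1 = s2.
Proof.
move=> pw c1 c2; have Uw : uniq w by rewrite (perm_uniq pw) iota_uniq.
apply/permP => x; apply: val_inj; have xw : val x \in w.
  by rewrite (perm_mem pw) mem_iota /= add0n ltn_ord.
move: (next_cycle c1 xw) (next_cycle c2 xw) => /eqP + /eqP.
by rewrite /actn inord_val /= => -> ->.
Qed.

Lemma fcycle_cycle_perm (w : seq 'I_N.+1) :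
  uniq w -> fcycle (actn (cycle_perm w)) (map val w).
Proof.
move=> Uw; rewrite cycle_map (@eq_cycle _ _ (frel (next w)));
  first exact: cycle_next.
by move=> x y /=; rewrite /actn inord_val -cycle_permE // val_eqE.
Qed.

Lemma ex_fcycle_actn w : perm_eq w (iota 0 N.+1) ->
  exists s, fcycle (actn s) w.
Proof.
move=> pw; have Uw : uniq w by rewrite (perm_uniq pw) iota_uniq.
have wN x : x \in w -> x < N.+1.
  by rewrite (perm_mem pw) mem_iota add0n.
have e : w = map val (map (@inord N) w).
  rewrite -map_comp -[LHS]map_id; apply/eq_in_map => x /wN xN /=.
  by rewrite inordK.
exists (cycle_perm (map inord w)); rewrite {2}e; apply: fcycle_cycle_perm.
by apply: (@map_uniq _ _ val); rewrite -e.
Qed.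

Lemma conjpC s x y : conjp s x y = conjp s y x.
Proof. by rewrite /conjp tpermC. Qed.

(* By cox_length_conj, this says that conjugation by (x, x + 1) preserves the
   length, when y = x + 1. *)
Definition conf s (x y : nat) : bool := conflict s (inord x) (inord y).

Lemma confC s x y : x < N.+1 -> y < N.+1 -> x <> y -> conf s x y = conf s y x.
Proof.
move=> xN yN xy; rewrite /conf /conflict.
have ne : inord x != inord y :> 'I_N.+1 by rewrite -val_eqE /= !inordK //;
  apply/eqP.
have n1 : s (inord x) != s (inord y) by rewrite (inj_eq perm_inj).
have n2 : (s^-1)%g (inord x) != (s^-1)%g (inord y) by rewrite (inj_eq perm_inj).
move: n1 n2; rewrite -!val_eqE /=; lia.
Qed.

(** In a cyclic word the image of a letter is its successor and the inverse image its predecessor,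
    so a conflict can be read off from the four neighbours of x and y. *)
Lemma conf_links s x y p q p' q' : p < N.+1 -> p' < N.+1 ->
  actn s p = x -> actn s x = q -> actn s p' = y -> actn s y = q' ->
  conf s x y = ((q < q') != (p < p')).
Proof.
move=> pN p'N px xq py yq; rewrite /conf /conflict -/(actn s x) -/(actn s y).
rewrite -/(actn s^-1 x) -/(actn s^-1 y) xq yq -px -py.
by rewrite -/(actn s^-1 (actn s p)) !actnK.
Qed.

(** The length-preserving conjugations, described without the length; [conf_edge_step] shows that
    they are steps in both directions. *)
Definition conf_edge : rel 'S_N.+1 := fun s s' =>
  [exists i : 'I_N.+1, exists j : 'I_N.+1,
    [&& j == i.+1 :> nat, conflict s i j & s' == (tperm i j * s * tperm i
      j)%g]].

Lemma conf_edge_length s s' : conf_edge s s' -> cox_length s' = cox_length s.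
Proof.
case/existsP => i /existsP[j /and3P[/eqP ij c /eqP ->]].
by have [->|] := cox_length_conj s ij; rewrite ?c // => /eqP.
Qed.

Lemma conf_edge_step s s' : conf_edge s s' -> cox_step s s' /\ cox_step s' s.
Proof.
move=> e; have L := conf_edge_length e; move: e.
case/existsP => i /existsP[j /and3P[ij c /eqP e]].
split; apply/existsP; exists i; apply/existsP; exists j;
  rewrite ij L leqnn andbT /=.
  by rewrite e.
by rewrite e !mulgA tperm2 mul1g -mulgA tperm2 mulg1.
Qed.

Lemma conf_edge_conjp s x y : x < N.+1 -> y < N.+1 ->
  (y == x.+1) || (x == y.+1) -> conf s x y -> conf_edge s (conjp s x y).
Proof.
move=> xN yN xy cxy.
wlog {xy} xy : x y xN yN cxy / y = x.+1.
  move=> H; case/orP: xy => /eqP xy; first exact: H.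
  by rewrite conjpC; apply: H => //; rewrite confC //; lia.
apply/existsP; exists (inord x); apply/existsP; exists (inord y).
apply/and3P; split; [by rewrite !inordK // xy|exact: cxy|exact: eqxx].
Qed.

Lemma step_conf_edge s s' : cox_step s s' -> cox_length s' = cox_length s ->
  s' = s \/ exists x, [/\ x.+1 < N.+1, conf s x x.+1 & s' = conjp s x x.+1].
Proof.
case/existsP => i /existsP[j /and3P[/eqP ij /eqP e _]] L.
have [e'|c] := cox_length_conj s ij; first by left; rewrite e.
right; exists i; have ii := inord_val i; have jj := inord_val j.
rewrite ij in jj; split; first by rewrite -ij.
  by rewrite /conf ii jj -c -e L.
by rewrite /conjp ii jj.
Qed.

End Action.

(** Breaks the computed form of an [fcycle] hypothesis into equations [actn s x = y] between
    neighbouring letters. *)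
Ltac split_links := repeat match goal with
  | H : is_true (_ && _) |- _ => case/andP: H => ? ?
  | H : is_true (_ == _) |- _ => move/eqP in H
  end.

(* Evaluates [conf s x y] from such equations; the second branch is for
   letters that follow each other, where one equation is used twice. *)
Ltac links := match goal with
  | e1 : actn ?s ?p = ?x, e2 : actn ?s ?x = ?q,
    e3 : actn ?s ?p' = ?y, e4 : actn ?s ?y = ?q' |- context [conf ?s ?x ?y] =>
    rewrite (@conf_links _ s x y p q p' q' _ _ e1 e2 e3 e4)
  | e1 : actn ?s ?p = ?x, e2 : actn ?s ?x = ?y, e4 : actn ?s ?y = ?q' |-
    context [conf ?s ?x ?y] =>
    rewrite (@conf_links _ s x y p y x q' _ _ e1 e2 e2 e4) end.

Lemma fcycle_rot1_imp (f : nat -> nat) v w :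
  fcycle f v -> rot 1 v = w \/ v = rot 1 w -> fcycle f w.
Proof. by move=> + [<-|e]; rewrite ?e rot_cycle. Qed.

(** The place of a new pair relative to the arc: one letter on each side, both on the left, both on
    the right. *)
Inductive move := Alt | Lft | Rgt.

(** * Words built by levels, and exchanges between consecutive levels *)

Section Ring.

Variables c h : nat.

(* The letters of level j: h + j is the large one, c - 1 - j the small one. *)
Definition letter (b : bool) (j : nat) : nat := if b then h + j else c.-1 - j.

(* A word in the letters of level at least j that starts with a letter of type
   t and ends with one of type ~~ t; it fills the gap of the cycle left by the
   arc of the letters of level below j. *)
Fixpoint ring (t : bool) (j : nat) (cs : seq move) : seq nat :=
  if cs is m :: cs' then
    match m with
    | Alt => letter t j :: ring (~~ t) j.+1 cs' ++ [:: letter (~~ t) j]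
    | Lft => ring t j.+1 cs' ++ [:: letter t j; letter (~~ t) j]
    | Rgt => letter t j :: letter (~~ t) j :: ring t j.+1 cs'
    end
  else [::].

(* inside j: of level below j (or the middle letter); outer b j: of type b and
   level at least j. *)
Definition inside (j x : nat) : bool := (c - j <= x) && (x < h + j).

Definition outer (b : bool) (j x : nat) : bool :=
  if b then h + j <= x < c + h else x < c - j.

Ltac compare_letters t :=
  links; repeat match goal with
  | o : is_true (outer _ _ _) |- _ => revert o
  | o : is_true (inside _ _) |- _ => revert o
  end;
  rewrite /outer /inside /letter; destruct t; rewrite /=; lia.

Ltac by_table m1 m2 := let H := fresh in move=> H; exists m1, m2;
  rewrite /= ?negbK -?catA /=; exact: H.

Lemma ring_all t j cs : j + size cs <= c ->
  all (fun x => outer false j x || outer true j x) (ring t j cs).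
Proof.
elim: cs t j => //= m cs IH t j jc.
have lt b : outer false j (letter b j) || outer true j (letter b j).
  by rewrite /outer /letter; case: b; lia.
have sub t' : all (fun x => outer false j x || outer true j x) (ring t' j.+1
  cs).
  have : j.+1 + size cs <= c by lia.
  by move/(IH t'); apply: sub_all => x; rewrite /outer; lia.
by case: m; rewrite /= ?all_cat /= ?lt ?sub.
Qed.

(** Alternation fixes the types of the two ends of a ring. Together with the bound on their level
    this decides every comparison of an end with letters of lower level. *)
Lemma ring_nil_or t j cs : j + size cs <= c -> cs = [::] \/
  exists y1 Y, [/\ ring t j cs = y1 :: Y,
    outer t j y1 & outer (~~ t) j (last y1 Y)].
Proof.
elim: cs t j => [|m cs IH] t j jc; [by left | right].
have lt b : outer b j (letter b j) by rewrite /= in jc;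
  rewrite /outer /letter; case: b; lia.
have up b x : outer b j.+1 x -> outer b j x by rewrite /outer; case: b; lia.
have jc' : j.+1 + size cs <= c by move: jc => /=; lia.
case: m {jc} => /=.
- exists (letter t j); eexists; split; [reflexivity|exact: lt|].
  by rewrite last_cat /= lt.
- have [->|[y1 [Y [-> o1 _]]]] := IH t _ jc'.
    by exists (letter t j), [:: letter (~~ t) j]; rewrite /= !lt.
  exists y1, (Y ++ [:: letter t j; letter (~~ t) j]); split => //;
    first exact: up.
  by rewrite last_cat /= lt.
- exists (letter t j); eexists; split; [reflexivity|exact: lt|].
  by have [->|[y1 [Y [-> _ o1]]]] := IH t _ jc'; rewrite /= ?lt ?up.
Qed.

Lemma ring1 t j m : ring t j [:: m] = [:: letter t j; letter (~~ t) j].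
Proof. by case: m. Qed.

Section Closure.

Variables (N : nat) (s : 'S_N.+1).
Hypotheses (Nch : N.+1 = c + h) (le_ch : c <= h).

Lemma letter_lt b j : j < c -> letter b j < N.+1.
Proof. by move=> jc; rewrite Nch /letter; case: b; lia. Qed.

Lemma swap_letterN b j i : j.+1 < c -> i < c ->
  swap (letter b j) (letter b j.+1) (letter (~~ b) i) = letter (~~ b) i.
Proof. by move=> jc ic; apply: swapN; rewrite /letter; case: b => /=; lia. Qed.

Lemma swap_ring b j t i cs : j.+2 <= i -> i + size cs <= c ->
  map (swap (letter b j) (letter b j.+1)) (ring t i cs) = ring t i cs.
Proof.
move=> ji ic; apply: map_swapN; apply/negP => /(allP (ring_all t ic));
rewrite /outer /letter; case: b; lia.
Qed.

Lemma swap_inside b j i S : i <= j -> j.+1 < c -> all (inside i) S ->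
  map (swap (letter b j) (letter b j.+1)) S = S.
Proof.
move=> ji jc inS; apply: map_swapN; apply/negP => /(allP inS);
rewrite /inside /letter; case: b; lia.
Qed.

Lemma word_lt j S t cs : j + size cs <= c -> all (inside j) S ->
  all (ltn^~ N.+1) (S ++ ring t j cs).
Proof.
move=> jc inS; rewrite all_cat; apply/andP; split.
  by apply: sub_all inS => z; rewrite /inside /= Nch; lia.
by apply: sub_all (ring_all t jc) => z; rewrite /outer /= Nch; lia.
Qed.

Lemma conjp_ring b j S t cs : j + (size cs).+2 <= c -> all (inside j) S ->
  forall m1 m2, fcycle (actn s) (S ++ ring t j [:: m1, m2 & cs]) ->
  fcycle (actn (conjp s (letter b j) (letter b j.+1)))
    (S ++ map (swap (letter b j) (letter b j.+1)) (ring t j [:: m1, m2 & cs])).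
Proof.
move=> jc inS m1 m2 fc; rewrite -{1}(@swap_inside b j j S) // -?map_cat;
  last lia.
by apply: fcycle_conjp => //;
  [apply: letter_lt|apply: letter_lt|exact: word_lt];
  lia.
Qed.

(* For b = t the pairs of moves AltAlt, LftRgt and AltLft, LftAlt are exchanged,
   for b = ~~ t the pairs AltAlt, RgtLft and AltRgt, RgtAlt; the other
   combinations have no conflict.  On the last level the three moves give the
   same word, so that Alt may be assumed there. *)
Lemma two_levels f S t j m1 m2 cs b :
  j + (size cs).+2 <= c -> all (inside j) (f :: S) ->
  fcycle (actn s) ((f :: S) ++ ring t j [:: m1, m2 & cs]) ->
  conf s (letter b j) (letter b j.+1) ->
  exists m1' m2', fcycle (actn (conjp s (letter b j) (letter b j.+1)))
    ((f :: S) ++ ring t j [:: m1', m2' & cs]).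
Proof.
move=> jc inS fc cf.
wlog lst : m2 fc / (cs = [::] -> m2 = Alt).
  move=> H; case: cs jc H fc => [|m cs] jc H fc; last exact: (H m2).
  apply: (H Alt) => //; move: fc; case: m1 {H} => /=;
  by case: m2.
set x := letter b j; set y := letter b j.+1.
have jc2 : j.+2 + size cs <= c by lia.
have Yfix t' : map (swap x y) (ring t' j.+2 cs) = ring t' j.+2 cs.
  exact: swap_ring.
have := conjp_ring b jc inS (fc : fcycle _ _); rewrite -/x -/y.
have sx : swap x y (letter b j) = letter b j.+1 by rewrite swapl.
have sy : swap x y (letter b j.+1) = letter b j by rewrite swapr.
have sn1 : swap x y (letter (~~ b) j) = letter (~~ b) j.
  by apply: swap_letterN; lia.
have sn2 : swap x y (letter (~~ b) j.+1) = letter (~~ b) j.+1.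
  by apply: swap_letterN; lia.
(* Expressing [b] through [t] lets the words compute in each of the 18 cases given by the two moves
   and the type. *)
have [e bt] : exists e, b = (if e then ~~ t else t).
  by exists (b != t); case: (b); case: (t).
case: m1 m2 e bt fc lst => [] [] [] bt fc lst; subst b.
all: rewrite ?negbK in sx sy sn1 sn2 *.
all: rewrite /= ?negbK ?map_cat /= ?sx ?sy ?sn1 ?sn2 ?map_cat /= ?sx ?sy ?sn1
  ?sn2 ?Yfix -?catA /=.
(* In the cases of the table the relabelled word is literally a word of the required shape. *)
all: try solve [by_table Alt Alt | by_table Alt Lft | by_table Alt Rgt |
  by_table Lft Alt
  | by_table Lft Rgt | by_table Rgt Alt | by_table Rgt Lft].
(* In every case that is left, the neighbours show that there is no conflict. Of the arc only the
   two ends occur as neighbours, and being inside places them between the small and the large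
   letters of level at least [j]. *)
all: move=> _.
all: have eN : last f S < N.+1
  by have /(allP inS) := mem_last f S; rewrite /inside /= Nch; lia.
all: have := mem_head f S => /(allP inS); have /(allP inS) := mem_last f S.
all: move: fc cf; rewrite /= ?negbK rcons_cat cat_path => /andP[_];
  move: (last f S) eN => e eN.
all: have [cs0|[y1 [Y [E o1 o2]]]] := ring_nil_or t jc2.
all: try solve [by move: lst; rewrite cs0 => /(_ erefl)].
all: have [cs1|[y1' [Y' [E' o1' o2']]]] := ring_nil_or (~~ t) jc2.
all: try solve [by move: E; rewrite cs1].
all: try solve [by move: E'; rewrite cs0].
all: move=> fc cf ei fi; exfalso; clear inS Yfix sx sy sn1 sn2.
all: rewrite -cats1 -?catA ?cs0 ?E ?E' /= ?cat_path ?last_cat /= in fc;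
  split_links.
all: move: cf; compare_letters t.
Qed.


(** The sorting step: a move other than [Alt] passes outwards over an [Alt]. Here the conflict is
    proved from the word instead of being assumed. *)
Lemma alt_last f S t j m cs :
  j + (size cs).+2 <= c -> all (inside j) (f :: S) -> m <> Alt ->
  fcycle (actn s) ((f :: S) ++ ring t j [:: m, Alt & cs]) ->
  exists2 s', conf_edge s s' &
    fcycle (actn s') ((f :: S) ++ ring t j [:: Alt, m & cs]).
Proof.
move=> jc inS mA fc.
(* The type of the letters whose exchange turns [m], [Alt] into [Alt], [m] in the table of
   [two_levels]. *)
pose b := if m is Lft then t else ~~ t.
set x := letter b j; set y := letter b j.+1.
have jc2 : j.+2 + size cs <= c by lia.
have Yfix t' : map (swap x y) (ring t' j.+2 cs) = ring t' j.+2 cs.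
  exact: swap_ring.
have fc' := conjp_ring b jc inS (fc : fcycle _ _).
rewrite -/x -/y in fc'.
have sx : swap x y (letter b j) = letter b j.+1 by rewrite swapl.
have sy : swap x y (letter b j.+1) = letter b j by rewrite swapr.
have sn1 : swap x y (letter (~~ b) j) = letter (~~ b) j.
  by apply: swap_letterN; lia.
have sn2 : swap x y (letter (~~ b) j.+1) = letter (~~ b) j.+1.
  by apply: swap_letterN; lia.
exists (conjp s x y); last first.
  case: m mA fc @b x y sx sy sn1 sn2 Yfix fc' =>
    // _ fc b x y sx sy sn1 sn2 Yfix;
  rewrite /b ?negbK in sx sy sn1 sn2;
  by rewrite /= ?negbK ?map_cat /= ?sx ?sy ?sn1 ?sn2 ?map_cat /= ?sx ?sy ?sn1
    ?sn2
    ?Yfix -?catA.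
apply: conf_edge_conjp; try (apply: letter_lt; lia).
  by rewrite /x /y /letter; case: (b); lia.
clear fc' Yfix sx sy sn1 sn2; subst x y.
have eN : last f S < N.+1
  by have /(allP inS) := mem_last f S; rewrite /inside /= Nch; lia.
have fi := allP inS _ (mem_head f S); have ei := allP inS _ (mem_last f S).
move: fc; rewrite /= rcons_cat cat_path => /andP[_].
move: (last f S) eN ei => e eN ei fc; clear inS.
have [cs0|[y1 [Y [E o1 o2]]]] := ring_nil_or t jc2;
have [cs1|[y1' [Y' [E' o1' o2']]]] := ring_nil_or (~~ t) jc2;
  try solve [by move: E; rewrite cs1]; try solve [by move: E'; rewrite cs0];
  subst b; case: m mA fc => // _ fc;
  rewrite -cats1 -?catA ?cs0 ?E ?E' ?negbK /= ?cat_path ?last_cat /= in fc;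
    split_links.
all: compare_letters t.
Qed.

End Closure.

Lemma fcycle_catC (f : nat -> nat) p q : fcycle f (p ++ q) = fcycle f (q ++ p).
Proof. by rewrite -(rot_size_cat p) rot_cycle. Qed.

(* Adding the pair of level j to the arc S, read around the cycle. *)
Definition grow (t : bool) (j : nat) (m : move) (S : seq nat) : seq nat :=
  match m with
  | Alt => letter (~~ t) j :: S ++ [:: letter t j]
  | Lft => letter t j :: letter (~~ t) j :: S
  | Rgt => S ++ [:: letter t j; letter (~~ t) j]
  end.

(* The type of the first letter of the ring that remains after the move m. *)
Definition flip (m : move) (t : bool) : bool := if m is Alt then ~~ t else t.

(** Passing the innermost pair from the ring to the arc only rotates the word. Inductions over the
    moves can thus count the levels already treated as part of the arc. *)
Lemma ring_push (f : nat -> nat) S t j m cs :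
  fcycle f (S ++ ring t j (m :: cs)) =
  fcycle f (grow t j m S ++ ring (flip m t) j.+1 cs).
Proof.
case: m => /=.
- by rewrite -cat_cons catA fcycle_catC /= -!catA.
- by rewrite catA fcycle_catC catA.
- by rewrite -catA.
Qed.

Lemma grow_inside t j m S : c <= h -> j < c -> all (inside j) S ->
  all (inside j.+1) (grow t j m S).
Proof.
move=> le_ch jc inS; have inS' : all (inside j.+1) S.
  by apply: sub_all inS => x; rewrite /inside; lia.
have lt b : inside j.+1 (letter b j) by rewrite /inside /letter; case: b; lia.
by case: m; rewrite /= ?all_cat /= ?inS' ?lt.
Qed.

Section Moves.

Variable N : nat.
Hypotheses (Nch : N.+1 = c + h) (le_ch : c <= h).
Implicit Types s : 'S_N.+1.

Lemma grow_neq0 t j m S : S != [::] -> grow t j m S != [::].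
Proof. by case: m S => [] []. Qed.

(** The levels below [l] are absorbed into the arc one after the other, until [two_levels] applies
    to the two innermost moves. *)
Lemma ring_closed s S t j cs b l :
  j + size cs <= c -> S != [::] -> all (inside j) S ->
  fcycle (actn s) (S ++ ring t j cs) ->
  j <= l -> l.+1 < j + size cs ->
  conf s (letter b l) (letter b l.+1) ->
  exists2 cs', size cs' = size cs &
    fcycle (actn (conjp s (letter b l) (letter b l.+1))) (S ++ ring t j cs').
Proof.
elim: cs S t j => [|m1 cs IH] S t j /= jc S0 inS fc jl lj cf; first lia.
have [jl'|lj'] : j = l \/ j < l by lia.
  case: cs {IH} => [|m2 cs] in jc fc lj *; first by move: lj => /=; lia.
  case: S S0 inS fc => // f S _ inS fc; rewrite -jl' in cf *.
  have jc' : j + (size cs).+2 <= c by move: jc => /=; lia.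
  have [m1' [m2' fc']] := two_levels Nch le_ch jc' inS fc cf.
  by exists [:: m1', m2' & cs].
move: fc; rewrite ring_push => fc.
have jc1 : j.+1 + size cs <= c by lia.
have jc2 : j < c by lia.
have lj1 : l.+1 < j.+1 + size cs by lia.
have [cs' sz fc'] :=
  IH _ _ _ jc1 (grow_neq0 t j m1 S0) (grow_inside t m1 le_ch jc2 inS) fc lj'
    lj1 cf.
by exists (m1 :: cs'); rewrite ?ring_push //= sz.
Qed.

End Moves.
End Ring.

(** Sorting by insertion: by induction the outer moves are already [Alt]; the first move is sent
    outwards by [alt_last] and the induction is used again. On the outermost level any move may be
    called [Alt], by [ring1]. *)
Lemma ring_alt c h N (s : 'S_N.+1) S t j cs :
  N.+1 = c + h -> c <= h -> j + size cs <= c -> S != [::] ->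
  all (inside c h j) S -> fcycle (actn s) (S ++ ring c h t j cs) ->
  exists2 s', connect (@conf_edge N) s s' &
    fcycle (actn s') (S ++ ring c h t j (nseq (size cs) Alt)).
Proof.
move=> Nch le_ch; move E : (size cs) => n.
elim: n s S t j cs E => [|n IH] s S t j [|m cs] //= E jc S0 inS fc;
  first by exists s.
case: E => E; have jc1 : j.+1 + n <= c by lia.
have jc2 : j < c by lia.
move: fc; rewrite ring_push => /(IH _ _ _ _ _ E jc1 (grow_neq0 c h t j m S0)
  (grow_inside t m le_ch jc2 inS)) [s1 c1].
rewrite -ring_push => fc1.
case: n => [|n] in E jc IH jc1 fc1 *; first by exists s1;
  rewrite // -/(ring c h t j [:: Alt]) ring1 -(ring1 c h t j m).
have [mA|mA] : m = Alt \/ m <> Alt by case: (m); [left|right|right].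
  by rewrite mA in fc1; exists s1.
case: S S0 inS fc1 => // f S S0 inS fc1.
have sz : size (nseq n Alt) = n by rewrite size_nseq.
have jc' : j + (size (nseq n Alt)).+2 <= c by rewrite sz.
have [s2 e2] := alt_last Nch le_ch jc' inS mA fc1.
rewrite ring_push => fc2.
have sz' : size (m :: nseq n Alt) = n.+1 by rewrite /= sz.
have [s3 c3] := IH _ _ _ _ _ sz' jc1 (grow_neq0 c h t j Alt S0)
  (grow_inside t Alt le_ch jc2 inS) fc2.
rewrite -ring_push => fc3.
by exists s3; rewrite // (connect_trans c1) // (connect_trans (connect1 e2)).
Qed.

(** * Exchanges that involve the core *)

Ltac compare_letters t :=
  links; repeat match goal with
  | o : is_true (outer _ _ _ _ _) |- _ => revert o
  | o : is_true (inside _ _ _ _) |- _ => revert o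
  end;
  rewrite /outer /inside /letter; destruct t; rewrite /=; lia.

(** An exchange at the core gives a word of the opposite type [~~ t], but only after a rotation by
    one place in one of the two directions. *)
Ltac by_rot t fc m rules := exists (~~ t), m; apply: (fcycle_rot1_imp fc);
  first [left; rewrite /= ?negbK ?map_cat /rot /= ?take0 ?drop0 ?map_cat /=
    !rules
           -?catA; reflexivity
        |right; rewrite /= ?negbK ?map_cat /rot /= ?take0 ?drop0 ?map_cat /=
          !rules
           -?catA; reflexivity].

Section EvenCore.

Variables (c N : nat) (s : 'S_N.+1).
Hypothesis Nc : N.+1 = c + c.

Local Notation lett := (letter c c).
Local Notation rng := (ring c c).
Local Notation pair t := [:: lett t 0; lett (~~ t) 0].

Lemma pair_inside t : 0 < c -> all (inside c c 1) (pair t).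
Proof. by rewrite /= /inside /letter; case: t => /=; lia. Qed.

(** The exchange reverses the core pair, so [t] becomes [~~ t]. For [b = t] the move [Alt] becomes
    [Lft] and [Rgt] becomes [Alt]; for [b = ~~ t], [Alt] becomes [Rgt] and [Lft] becomes [Alt]. The
    other combinations have no conflict. *)
Lemma pair_closed t m cs b : (size cs).+2 <= c ->
  fcycle (actn s) (pair t ++ rng t 1 (m :: cs)) ->
  conf s (lett b 0) (lett b 1) ->
  exists t' m', fcycle (actn (conjp s (lett b 0) (lett b 1)))
    (pair t' ++ rng t' 1 (m' :: cs)).
Proof.
move=> szc fc cf.
wlog lst : m fc / (cs = [::] -> m = Alt).
  move=> H; case: cs szc H fc => [|m' cs] szc H fc; last exact: (H m).
  by apply: (H Alt) => //; move: fc; rewrite !ring1.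
have jc2 : 2 + size cs <= c by lia.
set x := lett b 0; set y := lett b 1.
have Yfix t' : map (swap x y) (rng t' 2 cs) = rng t' 2 cs
  by exact: (swap_ring Nc (leqnn c)).
have sx : swap x y (lett b 0) = lett b 1 by rewrite swapl.
have sy : swap x y (lett b 1) = lett b 0 by rewrite swapr.
have sn1 : swap x y (lett (~~ b) 0) = lett (~~ b) 0.
  by apply: (swap_letterN Nc (leqnn c)); lia.
have sn2 : swap x y (lett (~~ b) 1) = lett (~~ b) 1.
  by apply: (swap_letterN Nc (leqnn c)); lia.
have wN : all (ltn^~ N.+1) (pair t ++ rng t 1 (m :: cs)).
  by apply: (word_lt Nc (leqnn c) (j := 1)) => //; apply: pair_inside; lia.
have := fcycle_conjp (letter_lt Nc (leqnn c) b (_ : 0 < c))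
  (letter_lt Nc (leqnn c) b (_ : 1 < c)) wN fc.
rewrite -/x -/y => /(_ (ltac:(lia)) (ltac:(lia))) fc'; clear wN.
have [e bt] : exists e, b = (if e then ~~ t else t).
  by exists (b != t); case: (b); case: (t).
have [cs0|[y1 [Y [E o1 o2]]]] := ring_nil_or c t jc2;
have [cs1|[y1' [Y' [E' o1' o2']]]] := ring_nil_or c (~~ t) jc2;
  try solve [by move: E; rewrite cs1]; try solve [by move: E'; rewrite cs0];
  case: e m bt fc fc' lst => [] [] bt fc fc' lst; subst b;
  try solve [by move: lst; rewrite cs0 => /(_ erefl)].
all: rewrite ?negbK in sn1 sn2; have rl := (sx, sy, sn1, sn2, Yfix).
all: try solve [by_rot t fc' Lft rl|by_rot t fc' Alt rl|by_rot t fc' Rgt rl].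
all: exfalso; clear rl fc' Yfix sx sy sn1 sn2; subst x y; move: cf.
all: rewrite /= -cats1 -?catA ?cs0 ?E ?E' ?negbK /= ?cat_path ?last_cat /= in
  fc; split_links.
all: compare_letters t.
Qed.

(** The entry [Alt], [b = t] of the table of [pair_closed], with its conflict proved; it serves to
    change the type of the word. *)
Lemma pair_flip t cs : (size cs).+2 <= c ->
  fcycle (actn s) (pair t ++ rng t 1 (Alt :: cs)) ->
  exists2 s', conf_edge s s' &
    fcycle (actn s') (pair (~~ t) ++ rng (~~ t) 1 (Lft :: cs)).
Proof.
move=> szc fc; have jc2 : 2 + size cs <= c by lia.
set x := lett t 0; set y := lett t 1.
have Yfix t' : map (swap x y) (rng t' 2 cs) = rng t' 2 cs
  by exact: (swap_ring Nc (leqnn c)).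
have sx : swap x y (lett t 0) = lett t 1 by rewrite swapl.
have sy : swap x y (lett t 1) = lett t 0 by rewrite swapr.
have sn1 : swap x y (lett (~~ t) 0) = lett (~~ t) 0.
  by apply: (swap_letterN Nc (leqnn c)); lia.
have sn2 : swap x y (lett (~~ t) 1) = lett (~~ t) 1.
  by apply: (swap_letterN Nc (leqnn c)); lia.
have wN : all (ltn^~ N.+1) (pair t ++ rng t 1 (Alt :: cs)).
  by apply: (word_lt Nc (leqnn c) (j := 1)) => //; apply: pair_inside; lia.
have xN : x < N.+1 by apply: (letter_lt Nc (leqnn c)); lia.
have yN : y < N.+1 by apply: (letter_lt Nc (leqnn c)); lia.
exists (conjp s x y); last first.
  apply: (fcycle_rot1_imp (fcycle_conjp xN yN wN fc)).
  by left; rewrite /= ?negbK ?map_cat /rot /= ?take0 ?drop0 ?map_cat /= ?sx ?sy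
    ?sn1
    ?sn2 ?Yfix -?catA.
apply: conf_edge_conjp => //; first by rewrite /x /y /letter; case: (t); lia.
clear Yfix sx sy sn1 sn2 wN; subst x y.
have [cs0|[y1 [Y [E o1 o2]]]] := ring_nil_or c (~~ t) jc2;
  rewrite /= -cats1 -?catA ?cs0 ?E ?negbK /= ?cat_path ?last_cat /= in fc;
    split_links.
all: compare_letters t.
Qed.

End EvenCore.

Section OddCore.

Variables (c N : nat) (s : 'S_N.+1).
Hypothesis Nc : N.+1 = c + c.+1.

Local Notation lett := (letter c c.+1).
Local Notation rng := (ring c c.+1).

Lemma mid_inside : all (inside c c.+1 0) [:: c].
Proof. by rewrite /= /inside; lia. Qed.

Lemma swap_mid_ring b t cs : 1 + size cs <= c ->
  map (swap c (lett b 0)) (rng t 1 cs) = rng t 1 cs.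
Proof.
move=> ic; apply: map_swapN; apply/negP => /(allP (ring_all c.+1 t ic));
rewrite /outer /letter; case: b; lia.
Qed.

Lemma swap_mid_letter b : 0 < c ->
  swap c (lett b 0) (lett (~~ b) 0) = lett (~~ b) 0.
Proof. by move=> c0; apply: swapN; rewrite /letter; case: b => /=; lia. Qed.

(** The middle letter plays the part of an innermost letter of either type: its exchange with a
    letter of level 0 follows the table of [pair_closed]. *)
Lemma mid_closed t m cs b : (size cs).+1 <= c ->
  fcycle (actn s) ([:: c] ++ rng t 0 (m :: cs)) ->
  conf s c (lett b 0) ->
  exists t' m', fcycle (actn (conjp s c (lett b 0)))
    ([:: c] ++ rng t' 0 (m' :: cs)).
Proof.
move=> szc fc cf.
wlog lst : m fc / (cs = [::] -> m = Alt).
  move=> H; case: cs szc H fc => [|m' cs] szc H fc; last exact: (H m).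
  by apply: (H Alt) => //; move: fc; rewrite !ring1.
have jc2 : 1 + size cs <= c by lia.
set x := c; set y := lett b 0.
have Yfix t' : map (swap x y) (rng t' 1 cs) = rng t' 1 cs
  by exact: swap_mid_ring.
have sx : swap x y c = lett b 0 by rewrite swapl.
have sy : swap x y (lett b 0) = c by rewrite swapr.
have sn1 : swap x y (lett (~~ b) 0) = lett (~~ b) 0 by apply: swap_mid_letter;
  lia.
have wN : all (ltn^~ N.+1) ([:: c] ++ rng t 0 (m :: cs)).
  by apply: (word_lt Nc (leqnSn c) (j := 0)) => //; exact: mid_inside.
have xN : x < N.+1 by rewrite Nc /x; lia.
have yN : y < N.+1 by apply: (letter_lt Nc (leqnSn c)); lia.
have fc' := fcycle_conjp xN yN wN fc; clear wN.
have [e bt] : exists e, b = (if e then ~~ t else t).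
  by exists (b != t); case: (b); case: (t).
have [cs0|[y1 [Y [E o1 o2]]]] := ring_nil_or c.+1 t jc2;
have [cs1|[y1' [Y' [E' o1' o2']]]] := ring_nil_or c.+1 (~~ t) jc2;
  try solve [by move: E; rewrite cs1]; try solve [by move: E'; rewrite cs0];
  case: e m bt fc fc' lst => [] [] bt fc fc' lst; subst b;
  try solve [by move: lst; rewrite cs0 => /(_ erefl)].
all: rewrite ?negbK in sn1; have rl := (sx, sy, sn1, Yfix).
all: try solve [by_rot t fc' Lft rl|by_rot t fc' Alt rl|by_rot t fc' Rgt rl].
all: exfalso; clear rl fc' Yfix sx sy sn1 yN; subst x y; move: cf.
all: rewrite /= -cats1 -?catA ?cs0 ?E ?E' ?negbK /= ?cat_path ?last_cat /= in
  fc; split_links.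
all: compare_letters t.
Qed.

Lemma mid_flip t cs : (size cs).+1 <= c ->
  fcycle (actn s) ([:: c] ++ rng t 0 (Alt :: cs)) ->
  exists2 s', conf_edge s s' &
    fcycle (actn s') ([:: c] ++ rng (~~ t) 0 (Lft :: cs)).
Proof.
move=> szc fc; have jc2 : 1 + size cs <= c by lia.
set x := c; set y := lett t 0.
have Yfix t' : map (swap x y) (rng t' 1 cs) = rng t' 1 cs
  by exact: swap_mid_ring.
have sx : swap x y c = lett t 0 by rewrite swapl.
have sy : swap x y (lett t 0) = c by rewrite swapr.
have sn1 : swap x y (lett (~~ t) 0) = lett (~~ t) 0 by apply: swap_mid_letter;
  lia.
have wN : all (ltn^~ N.+1) ([:: c] ++ rng t 0 (Alt :: cs)).
  by apply: (word_lt Nc (leqnSn c) (j := 0)) => //; exact: mid_inside.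
have xN : x < N.+1 by rewrite Nc /x; lia.
have yN : y < N.+1 by apply: (letter_lt Nc (leqnSn c)); lia.
exists (conjp s x y); last first.
  apply: (fcycle_rot1_imp (fcycle_conjp xN yN wN fc)).
  by left; rewrite /= ?negbK ?map_cat /rot /= ?take0 ?drop0 ?map_cat /= ?sx ?sy
    ?sn1
    ?Yfix -?catA.
apply: conf_edge_conjp => //; first by rewrite /x /y /letter; case: (t); lia.
clear Yfix sx sy sn1 wN yN; subst x y.
have [cs0|[y1 [Y [E o1 o2]]]] := ring_nil_or c.+1 (~~ t) jc2;
  rewrite /= -cats1 -?catA ?cs0 ?E ?negbK /= ?cat_path ?last_cat /= in fc;
    split_links.
all: compare_letters t.
Qed.

End OddCore.

(** For even size, c - 1 and c are the only successive integers that are not letters of one type.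
    They are adjacent in the word, and by alternation their predecessors and their successors are
    ordered alike. *)
Lemma pair_no_conf c N (s : 'S_N.+1) t cs : N.+1 = c + c -> 1 < c ->
  (size cs).+1 = c ->
  fcycle (actn s) ([:: letter c c t 0;
    letter c c (~~ t) 0] ++ ring c c t 1 cs) ->
  ~~ conf s (letter c c t 0) (letter c c (~~ t) 0).
Proof.
move=> Nc c1 sz fc; have jc2 : 1 + size cs <= c by lia.
have [cs0|[y1 [Y [E o1 o2]]]] := ring_nil_or c t jc2; first by move: sz;
  rewrite cs0 /=; lia.
have yN : last y1 Y < N.+1 by move: o2; rewrite Nc /outer;
  case: t {fc E o1} => /=; lia.
move: fc; rewrite E /= -cats1 cat_path /=.
case/and4P => /eqP e1 /eqP e2 _ /andP[/eqP e3 _].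
rewrite (@conf_links _ s _ _ _ _ _ _ yN (letter_lt Nc (leqnn c) t (ltnW c1)) e3
  e1 e1 e2).
by move: o1 o2; rewrite /outer /letter; case: t {e1 e2 e3 E} => /=; lia.
Qed.

(** * Complete words and their closure under length-preserving steps *)

Section Word.

Variables c h : nat.
Hypothesis ch : c <= h <= c.+1.

Definition core t : seq nat :=
  if c == h then [:: letter c h t 0; letter c h (~~ t) 0] else [:: c].

(** The boolean [c == h] is read as a number, the first level of the ring: 1 if the core is the pair
    of level 0, and 0 if it is the middle letter. *)
Definition word t cs : seq nat := core t ++ ring c h t (c == h) cs.

Lemma core_neq0 t : core t != [::].
Proof. by rewrite /core; case: ifP. Qed.

Lemma core_inside t : 0 < c -> all (inside c h (c == h)) (core t).
Proof.
move=> c0; rewrite /core; case: ifP => /eqP e /=; rewrite /inside /letter;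
  last lia.
by case: t => /=; lia.
Qed.

Lemma ring_perm t j m cs : perm_eq (ring c h t j (m :: cs))
  [:: letter c h t j, letter c h (~~ t) j & ring c h (flip m t) j.+1 cs].
Proof.
case: m => /=; last exact: perm_refl.
- by rewrite perm_cons perm_catC.
- by rewrite perm_catC.
Qed.

Lemma size_ring t j cs : size (ring c h t j cs) = (size cs).*2.
Proof.
elim: cs t j => //= m cs IH t j.
by rewrite (perm_size (ring_perm t j m cs)) /= IH.
Qed.

Lemma ring_uniq t j cs : j + size cs <= c -> uniq (ring c h t j cs).
Proof.
elim: cs t j => // m cs IH t j jc.
have jc1 : j.+1 + size cs <= c by move: jc => /=; lia.
rewrite (perm_uniq (ring_perm t j m cs)) /= IH // andbT inE.
have N b : letter c h b j \notin ring c h (flip m t) j.+1 cs.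
  apply/negP => /(allP (ring_all _ _ jc1)); rewrite /outer /letter; case: b;
    lia.
rewrite (negPf (N _)) orbF (N (~~ t)) andbT.
by rewrite /letter; apply/eqP; case: (t) => /=; lia.
Qed.

Lemma word_perm t cs : 0 < c -> size cs + (c == h) = c ->
  perm_eq (word t cs) (iota 0 (c + h)).
Proof.
move=> c0 sz; have jc : (c == h) + size cs <= c by lia.
have Uw : uniq (word t cs).
  rewrite cat_uniq ring_uniq // andbT; apply/andP; split.
    rewrite /core; case: ifP => //= _; rewrite andbT inE.
    by apply/eqP; rewrite /letter; case: t => /=; lia.
  apply/hasPn => x /(allP (ring_all _ _ jc)) ox; apply/negP.
  by move=> /(allP (core_inside t c0)); move: ox; rewrite /outer /inside /=;
    lia.
apply: uniq_perm => //; first exact: iota_uniq.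
have sub : {subset word t cs <= iota 0 (c + h)}.
  move=> x; rewrite mem_cat mem_iota add0n =>
    /orP[/(allP (core_inside t c0))|/(allP (ring_all _ _ jc))];
  by rewrite /inside /outer /=; case: eqP; lia.
have [] // := uniq_min_size Uw sub.
rewrite size_iota size_cat size_ring /core; move: sz.
by case: (c =P h) => [<-|ne] /=; rewrite ?addn1 ?addn0; lia.
Qed.

End Word.

(** The condition on the number of moves makes the word reach the outermost level, so that it
    contains every letter. *)
Definition nested N (s : 'S_N.+1) : Prop :=
  exists t cs, size cs + (N.+1./2 == uphalf N.+1) = N.+1./2 /\
    fcycle (actn s) (word N.+1./2 (uphalf N.+1) t cs).

Lemma word_conj c h N (s : 'S_N.+1) x t cs :
  N.+1 = c + h -> c <= h <= c.+1 -> 2 <= N -> size cs + (c == h) = c ->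
  x.+1 < N.+1 -> conf s x x.+1 -> fcycle (actn s) (word c h t cs) ->
  exists t' cs', size cs' + (c == h) = c /\
    fcycle (actn (conjp s x x.+1)) (word c h t' cs').
Proof.
move=> Nch ch N2 sz xN cf fc.
have le_ch : c <= h by case/andP: ch.
have c_gt0 : 0 < c by lia.
have jc : (c == h) + size cs <= c by lia.
have conf_letter y z : (x = y /\ x.+1 = z) \/ (x = z /\ x.+1 = y) -> conf s y z.
  by case=> -[<- <-] //; rewrite confC //; lia.
have conjp_letter y z : (x = y /\ x.+1 = z) \/ (x = z /\ x.+1 = y) ->
    conjp s x x.+1 = conjp s y z.
  by case=> -[<- <-] //; rewrite conjpC.
have ringc b l : (c == h) <= l -> l.+1 < c ->
    (x = letter c h b l /\ x.+1 = letter c h b l.+1) \/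
    (x = letter c h b l.+1 /\ x.+1 = letter c h b l) ->
    exists t cs, size cs + (c == h) = c /\ fcycle (actn (conjp s x x.+1)) (word
      c h t cs).
  move=> hl lc xl; rewrite (conjp_letter _ _ xl).
  have lj : l.+1 < (c == h) + size cs by lia.
  have [cs' sz' fc'] := ring_closed Nch le_ch jc (core_neq0 c h t)
    (core_inside ch t c_gt0) fc hl lj (conf_letter _ _ xl).
  by exists t, cs'; rewrite sz'.
have [e|e] : h = c \/ h = c.+1 by lia.
- subst h; rewrite eqxx in sz jc ringc *.
  have c_gt1 : 1 < c by lia.
  case: cs => [|m cs] in sz fc jc *; first by move: sz => /=; lia.
  have szc : (size cs).+2 <= c by move: sz => /=; lia.
  move: fc; rewrite /word /core eqxx => fc.
  have incore b : (x = letter c c b 0 /\ x.+1 = letter c c b 1) \/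
      (x = letter c c b 1 /\ x.+1 = letter c c b 0) ->
      exists t' cs', size cs' + true = c /\ fcycle (actn (conjp s x x.+1))
        ([:: letter c c t' 0; letter c c (~~ t') 0] ++ ring c c t' 1 cs').
    move=> xl; rewrite (conjp_letter _ _ xl).
    have [t' [m' fc']] := pair_closed Nch szc fc (conf_letter _ _ xl).
    by exists t', (m' :: cs).
  (* Among small letters the smaller one has the higher level, hence the level c - (x + 2) in the
     first case. The middle case is the innermost pair; the cases next to it join levels 0 and 1 and
     so touch the core. *)
  have [x1|[x1|[x1|[x1|x1]]]] :
    x.+2 < c \/ x.+2 = c \/ x.+1 = c \/ x = c \/ c < x by lia.
  + rewrite /word /core eqxx in ringc.
    by apply: (ringc false (c - x.+2)); rewrite /letter; lia.
  + by apply: (incore false); rewrite /letter; lia.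
  + have := pair_no_conf Nch c_gt1 _ fc; rewrite conf_letter ?addn1 in sz *.
      by move=> /(_ sz).
    by rewrite /letter; case: (t) => /=; lia.
  + by apply: (incore true); rewrite /letter; lia.
  + rewrite /word /core eqxx in ringc.
    by apply: (ringc true (x - c)); rewrite /letter; lia.
subst h; have ne : (c == c.+1) = false by lia.
rewrite ne in sz jc ringc *; rewrite /word /core ne in fc ringc *.
case: cs => [|m cs] in sz fc jc *; first by move: sz => /=; lia.
have szc : (size cs).+1 <= c by move: sz => /=; lia.
have incore b : (x = c /\ x.+1 = letter c c.+1 b 0) \/
    (x = letter c c.+1 b 0 /\ x.+1 = c) ->
    exists t' cs', size cs' + false = c /\ fcycle (actn (conjp s x x.+1))
      ([:: c] ++ ring c c.+1 t' 0 cs').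
  move=> xl; rewrite (conjp_letter _ _ xl).
  have [t' [m' fc']] := mid_closed Nch szc fc (conf_letter _ _ xl).
  by exists t', (m' :: cs).
(* Here the core letter c is next to both letters of level 0. *)
have [x1|[x1|[x1|x1]]] : x.+1 < c \/ x.+1 = c \/ x = c \/ c < x by lia.
- by apply: (ringc false (c - x.+2)); rewrite /letter; lia.
- by apply: (incore false); rewrite /letter; lia.
- by apply: (incore true); rewrite /letter; lia.
- by apply: (ringc true (x - c.+1)); rewrite /letter; lia.
Qed.

Lemma word_flip c h N (s : 'S_N.+1) t (cs : seq move) :
  N.+1 = c + h -> c <= h <= c.+1 -> 2 <= N -> size cs + (c == h) = c ->
  fcycle (actn s) (word c h t (nseq (size cs) Alt)) ->
  exists s' cs', [/\ conf_edge s s', size cs' = size cs &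
    fcycle (actn s') (word c h (~~ t) cs')].
Proof.
move=> Nch ch N2; rewrite /word /core.
have [e|e] : h = c \/ h = c.+1 by lia.
- subst h; rewrite eqxx; case: cs => [|m cs] /= sz fc; first lia.
  have szc : (size (nseq (size cs) Alt)).+2 <= c by rewrite size_nseq; lia.
  have [s' e fc'] := pair_flip Nch szc fc.
  by exists s', (Lft :: nseq (size cs) Alt); rewrite /= size_nseq.
subst h; have -> : (c == c.+1) = false by lia.
case: cs => [|m cs] /= sz fc; first lia.
have szc : (size (nseq (size cs) Alt)).+1 <= c by rewrite size_nseq; lia.
have [s' e fc'] := mid_flip Nch szc fc.
by exists s', (Lft :: nseq (size cs) Alt); rewrite /= size_nseq.
Qed.

(** * The class of the stair form *)

Section Shape.

Variable N : nat.
Hypothesis N2 : 2 <= N.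
Implicit Types s : 'S_N.+1.

Local Notation c := N.+1./2.
Local Notation h := (uphalf N.+1).

Lemma half_uphalf : N.+1 = c + h.
Proof. by lia. Qed.

Lemma half_le_uphalf : c <= h <= c.+1.
Proof. by lia. Qed.

Lemma nested_edge s s' : cox_step s s' -> cox_length s' = cox_length s ->
  nested s -> nested s'.
Proof.
move=> st L; have [-> //|[x [xN cf ->]] [t [cs [sz fc]]]] :=
  step_conf_edge st L.
exact: (word_conj half_uphalf half_le_uphalf N2 sz xN cf fc).
Qed.

Lemma word_alt s t cs : size cs + (c == h) = c ->
  fcycle (actn s) (word c h t cs) ->
  exists2 s', connect (@conf_edge N) s s' &
    fcycle (actn s') (word c h t (nseq (size cs) Alt)).
Proof.
move=> sz fc; have /andP[le_ch _] := half_le_uphalf.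
apply: (ring_alt half_uphalf le_ch _ (core_neq0 c h t)) => //; first by lia.
by apply: core_inside half_le_uphalf _ _; lia.
Qed.

(** A normal form. A word of type [true] is sorted first and then flipped; the flip creates a [Lft],
    so the moves are sorted once more. *)
Lemma nested_alt s : nested s -> exists2 s', connect (@conf_edge N) s s' &
  fcycle (actn s') (word c h false (nseq (c - (c == h)) Alt)).
Proof.
case=> [t [cs [sz fc]]]; have szE : size cs = c - (c == h) by lia.
have [s1 e1 f1] := word_alt sz fc.
case: t {fc} f1 => f1; last by exists s1; rewrite -?szE.
have [s2 [cs2 [e2 sz2 f2]]] := word_flip half_uphalf half_le_uphalf N2 sz f1.
rewrite -sz2 in sz szE *.
have [s3 e3 f3] := word_alt sz f2.
exists s3; rewrite -?szE //.
by rewrite (connect_trans e1) // (connect_trans (connect1 e2)).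
Qed.

Lemma conf_connect_approx s s' : connect (@conf_edge N) s s' -> cox_approx s s'.
Proof.
case/connectP => p; elim: p s => /= [|s1 p IH] s; first by move=> _ ->;
  rewrite /cox_approx !connect0.
case/andP => /conf_edge_step[st1 st2] /IH + e => /(_ e) /andP[c1 c2].
rewrite /cox_approx (connect_trans (connect1 st1)) //=.
exact: connect_trans c2 (connect1 st2).
Qed.

(** Both are connected to the same normal form, as a word with all letters determines the
    permutation. *)
Lemma nested_approx s s' : nested s -> nested s' -> cox_approx s s'.
Proof.
move=> /nested_alt[a c1 f1] /nested_alt[a' c2 f2].
have e : a = a'.
  apply: fcycle_actn_inj f1 f2; rewrite [in X in iota 0 X]half_uphalf.
  by apply: word_perm; rewrite ?half_le_uphalf ?size_nseq //; lia.
have /andP[p1 p2] := conf_connect_approx c1.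
have /andP[q1 q2] := conf_connect_approx c2.
by rewrite /cox_approx e in p1 p2 *;
  rewrite (connect_trans p1) //= (connect_trans q1).
Qed.

Lemma step_length s s' : cox_step s s' -> cox_length s' <= cox_length s.
Proof. by case/existsP => i /existsP[j /and3P[]]. Qed.

Lemma connect_length s s' : connect (@cox_step N.+1) s s' ->
  cox_length s' <= cox_length s.
Proof.
case/connectP => p; elim: p s => /= [|s1 p IH] s; first by move=> _ ->.
by case/andP => /step_length le1 /IH + e => /(_ e) le2; apply: leq_trans le1.
Qed.

(** Steps never increase the length, and the path back shows that it does not drop; so each step of
    the path preserves it and [nested_edge] applies. *)
Lemma approx_nested s s' : cox_approx s s' -> nested s -> nested s'.
Proof.
case/andP => c1 /connect_length; move: c1.
case/connectP => p; elim: p s => /= [|s1 p IH] s; first by move=> _ ->.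
case/andP => st pth e L sh.
have L1 := step_length st.
have L2 : cox_length s' <= cox_length s1.
  by apply: connect_length; apply/connectP; exists p.
apply: (IH s1) => //; first exact: leq_trans L1 L.
apply: nested_edge st _ sh; apply/eqP; rewrite eqn_leq L1;
  exact: leq_trans L L2.
Qed.

Definition stair_nat (i : nat) : nat := if odd i then c + h - i./2.+1 else i./2.

(** With [Lft] moves only, every pair stands to the left of the previous ones, so the reading starts
    at the outermost pair and goes inwards, as the stair form does. *)
Lemma ring_lft k j : j + k = c ->
  ring c h false j (nseq k Lft) = mkseq stair_nat k.*2.
Proof.
elim: k j => // k IH j jk; rewrite /= (IH j.+1) ?doubleS; last by lia.
rewrite /mkseq -[k.*2.+2]addn2 iotaD map_cat /= add0n; congr (_ ++ [:: _; _]);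
rewrite /stair_nat /letter /= ?odd_double ?uphalf_double ?doubleK /=; lia.
Qed.

Lemma nested_stair : nested (stair N.+1).
Proof.
exists false, (nseq (c - (c == h)) Lft); rewrite size_nseq; split; first by lia.
rewrite /word.
rewrite fcycle_catC ring_lft; last by lia.
have -> : mkseq stair_nat (c - (c == h)).*2 ++ core c h false =
    map val [seq stair_entry j | j <- enum 'I_N.+1].
  rewrite -map_comp (eq_map (g := stair_nat \o val)); last first.
    by move=> i; rewrite /= /stair_nat -half_uphalf.
  rewrite map_comp val_enum_ord [in RHS]half_uphalf /core.
  have [e|e] : h = c \/ h = c.+1 by lia.
    rewrite e eqxx addnn; rewrite -[in RHS](_ : (c - true).*2 + 2 = c.*2);
      last by lia.
    rewrite iotaD map_cat; congr (_ ++ [:: _; _]);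
    rewrite /stair_nat /letter /= ?add0n ?odd_double ?uphalf_double ?doubleK
      /=; lia.
  rewrite e (_ : c == c.+1 = false); last by lia.
  rewrite subn0 -[in RHS](_ : c.*2 + 1 = c + c.+1); last by lia.
  by rewrite iotaD map_cat; congr (_ ++ [:: _]);
    rewrite /stair_nat /= ?add0n ?odd_double ?uphalf_double ?doubleK /=; lia.
exact: fcycle_cycle_perm (stair_uniq N.+1).
Qed.

Lemma SigmaP s : reflect (nested s) (s \in Sigma N.+1).
Proof.
rewrite inE; apply: (iffP idP) => [/approx_nested|]; first by apply;
  exact: nested_stair.
exact: nested_approx nested_stair.
Qed.

End Shape.

(** * The insertion operator on cyclic words *)

Lemma fcycle_traject (f : nat -> nat) x w :
  fcycle f (x :: w) -> x :: w = traject f x (size w).+1 /\ iter (size w).+1 f x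
    = x.
Proof.
move=> /= /fpathP[k e].
have sk : k = (size w).+1 by have := congr1 size e;
  rewrite size_rcons size_traject.
have : rcons (x :: w) x = traject f x (size w).+2 by rewrite rcons_cons e sk.
by rewrite trajectSr => /rcons_inj e'; split;
  [exact: (congr1 fst e')|exact: esym (congr1 snd e')].
Qed.

Section Insertion.

Variable N : nat.
Implicit Type s : 'S_N.+1.

Definition full_cycle s := exists2 w,
  perm_eq w (iota 0 N.+1) & fcycle (actn s) w.

Local Notation orbit0 s := (traject (actn s) 0 N.+1).

Lemma full_cycle_orbit s : full_cycle s ->
  [/\ perm_eq (orbit0 s) (iota 0 N.+1), fcycle (actn s) (orbit0 s) &
      iter N.+1 (actn s) 0 = 0].
Proof.
case=> w pw fw; have w0 : 0 \in w by rewrite (perm_mem pw) mem_iota.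
have [i w' e] := rot_to w0; rewrite -(rot_cycle i) e in fw.
have pw' : perm_eq (0 :: w') (iota 0 N.+1) by rewrite -e perm_rot.
have sz : size w' = N by move/perm_size: pw' => /=; rewrite size_iota => -[].
by have [e1 e2] := fcycle_traject fw; rewrite sz in e1 e2; rewrite -e1.
Qed.

Lemma orbit_inj s i j : full_cycle s -> i < N.+1 -> j < N.+1 ->
  iter i (actn s) 0 = iter j (actn s) 0 -> i = j.
Proof.
move=> /full_cycle_orbit[pw _ _] iN jN e; have := iota_uniq 0 N.+1.
rewrite -(perm_uniq pw) => /(uniqP 0); apply; rewrite ?inE ?size_traject //.
by rewrite !nth_traject.
Qed.

Lemma orbit_onto s y : full_cycle s -> y < N.+1 ->
  exists2 i, i < N.+1 & iter i (actn s) 0 = y.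
Proof.
move=> /full_cycle_orbit[pw _ _] yN; have : y \in orbit0 s.
  by rewrite (perm_mem pw) mem_iota.
by case/trajectP => i iN ->; exists i.
Qed.

Lemma pt1X s r : (s ^+ r)%g (pt N 1) = iter r (actn s) 0 :> nat.
Proof. by rewrite actnX. Qed.

(** This frees the insertion from the cycle notation that starts with the first letter: when the
    cycle is rotated to end with its [p]th entry y, the new letter just stands in front. *)
Lemma ins_fcycle s k p v y : full_cycle s -> 1 < k <= N.+2 -> 0 < p <= N.+1 ->
  size v = N -> fcycle (actn s) (rcons v y) -> iter p.-1 (actn s) 0 = y ->
  fcycle (actn (ins k p s)) (k.-1 :: map (bump k.-1) (rcons v y)).
Proof.
move=> fs kN pN sv fv py.
have [pw fw itN] := full_cycle_orbit fs.
pose T := orbit0 s.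
(* Both words end with y; with y moved to the front they are trajectories of y of equal length. *)
have eT : rot p T = rcons v y.
  have fr : fcycle (actn s) (rot p T) by rewrite rot_cycle.
  have : size (rot p T) = N.+1 by rewrite size_rot size_traject.
  have : last 0 (rot p T) = y.
    have pE : p = p.-1.+1 by lia.
    rewrite /rot last_cat {2}pE (take_nth 0) ?size_traject; last by lia.
    by rewrite last_rcons nth_traject //; lia.
  case/lastP: (rot p T) fr => // v' y' fr;
    rewrite last_rcons size_rcons => yy [sv']; rewrite {}yy in fr *.
  move: fr fv; rewrite -!rot1_cons !rot_cycle =>
    /fcycle_traject[e' _] /fcycle_traject[e _].
  by congr rot; rewrite e e' sv sv'.
have valE r : val (ins_entry k p s r) =
    if r < p then bump k.-1 (iter r (actn s) 0)
    else if r == p then k.-1 else bump k.-1 (iter r.-1 (actn s) 0).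
  by rewrite /ins_entry; case: ifP => _; last case: ifP => _;
    rewrite /= ?pt1X /pt inordK //; lia.
pose e := mkseq (ins_entry k p s) N.+2.
have eE : map val e = map (bump k.-1) (take p T) ++ k.-1 :: map (bump k.-1)
  (drop p T).
  rewrite /e /mkseq -map_comp.
  have -> : iota 0 N.+2 = iota 0 (p + (1 + (N.+1 - p))) by congr iota; lia.
  rewrite iotaD map_cat iotaD map_cat /= add0n addn1.
  have TE : T = map (fun r => iter r (actn s) 0) (iota 0 N.+1).
    by apply: (@eq_from_nth _ 0);
      rewrite ?size_traject ?size_map ?size_iota // => i iN;
      rewrite nth_traject // (nth_map 0) ?size_iota // nth_iota.
  congr (_ ++ _ :: _).
  - rewrite TE -!map_take take_iota -map_comp.
    rewrite (_ : minn p N.+1 = p); last by lia.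
    apply/eq_in_map => r; rewrite mem_iota /= add0n => rp.
    by rewrite valE rp.
  - by rewrite valE ltnn eqxx.
  rewrite TE -!map_drop drop_iota -map_comp add0n -[p.+1]add1n iotaDl -map_comp.
  apply/eq_in_map => r; rewrite mem_iota => /andP[pr _] /=.
  by rewrite valE add1n /= ltnNge leqW //= gtn_eqF.
have Ue : uniq e.
  apply: (@map_uniq _ _ val); rewrite eE.
  rewrite (perm_uniq (_ : perm_eq _ (k.-1 :: map (bump k.-1) T))); last first.
    by rewrite -{3}(cat_take_drop p T) map_cat perm_catC /= perm_cons perm_catC.
  rewrite cons_uniq (map_inj_uniq (can_inj (@bumpK _))) (perm_uniq (pw :
    perm_eq T _)) iota_uniq andbT.
  by apply/mapP => -[z _ /eqP]; rewrite (negPf (neq_bump _ _)).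
have := fcycle_cycle_perm Ue; rewrite eE fcycle_catC => fe.
by rewrite -eT /rot map_cat -cat_cons.
Qed.

End Insertion.

(** All entries but the one at [p] lie in the image of [lift], which misses the inserted letter;
    this recovers [p], and injectivity of [lift] recovers the orbit. *)
Lemma ins_inj N k p p' (s s' : 'S_N.+1) :
  full_cycle s -> full_cycle s' -> 1 < k <= N.+2 ->
  0 < p <= N.+1 -> 0 < p' <= N.+1 -> ins k p s = ins k p' s' ->
    p = p' /\ s = s'.
Proof.
move=> fs fs' kN pN p'N e.
have Us (u : 'S_N.+1) : full_cycle u ->
  uniq (mkseq (fun r => (u ^+ r)%g (pt N 1)) N.+1).
  move=> fu; apply/mkseq_uniqP => i j; rewrite !inE => iN jN /(congr1 val).
  by rewrite /= !pt1X; apply: orbit_inj.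
have ee r : r <= N.+1 -> ins_entry k p s r = ins_entry k p' s' r.
  by move=> rN; rewrite -(insX (Us _ fs) kN pN rN) e (insX (Us _ fs') kN p'N
    rN).
have pp : p = p'.
  have /ee : p <= N.+1 by case/andP: pN.
  rewrite /ins_entry ltnn eqxx; case: ltngtP => // _ /eqP;
  by rewrite (negPf (neq_lift _ _)).
split=> //; subst p'.
have [pw fw _] := full_cycle_orbit fs; have [_ fw' _] := full_cycle_orbit fs'.
apply: fcycle_actn_inj pw fw _;
  suff -> : traject (actn s) 0 N.+1 = traject (actn s') 0 N.+1 by [].
apply: (@eq_from_nth _ 0); rewrite ?size_traject // => r rN.
rewrite !nth_traject // -!pt1X; congr val.
have [rp|pr] := ltnP r p.
  by have /ee := ltnW rN; rewrite /ins_entry rp => /lift_inj.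
have /ee : r.+1 <= N.+1 by [].
rewrite /ins_entry ltnNge leqW //= gtn_eqF ?ltnS //; exact: lift_inj.
Qed.

Lemma the_in_unique a b (P : pred nat) p : a <= p <= b -> P p ->
  (forall q, a <= q <= b -> P q -> q = p) -> the_in a b P = p.
Proof.
move=> pab Pp uP; rewrite /the_in.
have : p \in [seq q <- iota a (b.+1 - a) | P q].
  by rewrite mem_filter Pp mem_iota; lia.
case E : [seq q <- _ | _] => [//|q w] _ /=.
have : q \in [seq q <- iota a (b.+1 - a) | P q] by rewrite E mem_head.
rewrite mem_filter mem_iota => /andP[Pq qab]; apply: uP => //; lia.
Qed.

Lemma nested_full N (s : 'S_N.+1) : 2 <= N -> nested s -> full_cycle s.
Proof.
move=> N2 [t [cs [sz fc]]]; exists (word N.+1./2 (uphalf N.+1) t cs) => //.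
by rewrite [in X in iota 0 X](half_uphalf N2); apply: word_perm;
  rewrite ?(half_le_uphalf N2) //; lia.
Qed.

(** Here [i] is the shift of the levels: 1 if the insertion completes a new innermost pair, 0 if it
    creates a middle letter. *)
Lemma map_bump_ring c h c' h' k i j t cs :
  (forall b l, j <= l -> l < j + size cs ->
     bump k (letter c h b l) = letter c' h' b (i + l)) ->
  map (bump k) (ring c h t j cs) = ring c' h' t (i + j) cs.
Proof.
elim: cs t j => //= m cs IH t j H.
have H0 b : bump k (letter c h b j) = letter c' h' b (i + j) by apply: H; lia.
have H1 t' : map (bump k) (ring c h t' j.+1 cs) = ring c' h' t' (i + j).+1 cs.
  by rewrite IH ?addnS // => b l jl lj; apply: H; lia.
by case: m; rewrite /= ?map_cat /= ?H0 ?H1.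
Qed.

(** * The two insertions on nested words *)

Section Even.

Variables (N c : nat).
Hypotheses (Nc : N.+1 = c + c.+1) (c1 : 0 < c).
Implicit Type s : 'S_N.+1.

(** The old middle letter c becomes small and the new letter c + 1 is its partner. Alternation puts
    c + 1 before c if the predecessor of c is small, and behind c if it is large; the minimum
    selects that predecessor in the first case and c in the second. *)
Lemma even_fcycle s t cs : size cs = c ->
  fcycle (actn s) (word c c.+1 t cs) ->
  exists p, [/\ 0 < p <= N.+1, even_pos s p,
    forall q, 0 < q <= N.+1 -> even_pos s q -> q = p &
    fcycle (actn (ins N.+2./2.+1 p s)) (word c.+1 c.+1 t cs)].
Proof.
move=> sz fc.
have ne : (c == c.+1) = false by lia.
have pw : perm_eq (word c c.+1 t cs) (iota 0 N.+1).
  by rewrite Nc; apply: word_perm; rewrite ?ne; lia.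
have fs : full_cycle s by exists (word c c.+1 t cs).
rewrite /word /core ne in fc pw.
pose y := minn (actn s^-1 c) c.
have yN : y < N.+1 by rewrite Nc /y; lia.
have cN : c < N.+1 by lia.
have hN : N.+2./2 = c.+1 by lia.
have posE p : even_pos s p = (iter p.-1 (actn s) 0 == y).
  by rewrite /even_pos pt1X hN /pt /= inordK.
have [i iN iy] := orbit_onto fs yN.
rewrite hN; exists i.+1; split=> //; first by rewrite posE iy.
  move=> q qN; rewrite posE -iy => /eqP/(orbit_inj fs) qi.
  have := qi _ iN; lia.
have jc : 0 + size cs <= c by rewrite sz.
have kN : 1 < c.+2 <= N.+2 by lia.
have rE t' : map (bump c.+1) (ring c c.+1 t' 0 cs) = ring c.+1 c.+1 t' 1 cs.
  by apply: (map_bump_ring (i := 1)) => b l _ lc; rewrite /letter /bump;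
    case: b; lia.
have bc : bump c.+1 c = c by rewrite /bump; lia.
rewrite /word /core eqxx -rE.
have [cs0|[y1 [Y [E o1 o2]]]] := ring_nil_or c.+1 t jc; first by move: sz;
  rewrite cs0 /=; lia.
have sN := perm_size pw; rewrite size_iota E /= in sN.
have last_c : actn s^-1 c = last y1 Y.
  move: fc; rewrite E /= -cats1 cat_path /= => /and4P[_ _ /eqP <- _].
  by rewrite actnK //; move: o2; rewrite /outer; case: t {E o1 pw} => /=; lia.
have yE : y = if t then last y1 Y else c.
  by rewrite /y last_c; move: o2; rewrite /outer; case: t {E o1 pw fc} => /=;
    lia.
case: t fc pw E o1 o2 yE => /= fc pw E o1 o2 yE.
- have := @ins_fcycle _ s c.+2 i.+1 (c :: belast y1 Y) y fs kN iN.
  rewrite yE rcons_cons -lastI -E /= size_belast -yE => /(_ _ _ iy).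
  rewrite bc => H.
rewrite addn0 subn0.
  by apply: H => //; lia.
rewrite addn0 subn0.
suff : fcycle (actn (ins c.+2 i.+1 s))
  [:: c, c.+1 & map (bump c.+1) (ring c c.+1 false 0 cs)] by [].
have := @ins_fcycle _ s c.+2 i.+1 (y1 :: Y) y fs kN iN.
rewrite yE -E -cats1 -fcycle_catC => /(_ _ fc) H.
apply: fcycle_rot1_imp (H _ _) _; [by rewrite E; move: sN => /=;
  lia|by rewrite -yE|right].
by rewrite map_cat /= bc rot1_cons -cats1.
Qed.

End Even.

(* The offset q of the statement at which the new middle letter of the word
   starting with the move m is inserted. *)
Definition gap (m : move) : nat :=
  match m with Rgt => 0 | Alt => 1 | Lft => 2 end.

Section Odd.

Variables (N c : nat).
Hypotheses (Nc : N.+1 = c + c) (c2 : 1 < c).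
Implicit Type s : 'S_N.+1.

(** Let y, A, B be the core pair with its predecessor. The new letter goes behind y, A or B; read
    from there, the word starts with A B, starts with B and ends with A, or ends with A B. These are
    the moves [Rgt], [Alt], [Lft], and only for [Alt] does the type change. *)
Lemma odd_fcycle s t cs : size cs + 1 = c ->
  fcycle (actn s) (word c c t cs) ->
  exists p, [/\ 0 < p <= N.-1, odd_pos s p,
    forall q, 0 < q <= N.-1 -> odd_pos s q -> q = p &
    forall m, fcycle (actn (ins N.+3./2 (p + gap m) s))
                (word c c.+1 (flip m t) (m :: cs))].
Proof.
move=> sz fc; have ch : c <= c <= c.+1 by lia.
have pw : perm_eq (word c c t cs) (iota 0 N.+1).
  by rewrite Nc; apply: word_perm; rewrite ?eqxx //; lia.
have fs : full_cycle s by exists (word c c t cs).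
have [_ _ it0] := full_cycle_orbit fs.
rewrite /word /core eqxx in fc pw.
have mN : N.+3./2 = c.+1 by lia.
have mN' : N./2.+1 = c by lia.
have jc : 1 + size cs <= c by lia.
have [cs0|[y1 [Y [E o1 o2]]]] := ring_nil_or c t jc; first by move: sz;
  rewrite cs0 /=; lia.
pose A := letter c c t 0; pose B := letter c c (~~ t) 0.
pose y := last y1 Y.
have [AN BN] : A < N.+1 /\ B < N.+1 by rewrite /A /B Nc /letter;
  case: (t) => /=; lia.
have yN : y < N.+1 by rewrite /y Nc; move: o2; rewrite /outer;
  case: (t) => /=; lia.
have fc' := fc; rewrite E /= -cats1 cat_path /= in fc'.
case/and4P: fc' => /eqP sA /eqP sB _ /andP[/eqP sy _].
have AB x : (x \in [:: c.-1; c]) = (x == A) || (x == B).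
  by rewrite !inE /A /B /letter; case: (t) => /=; lia.
have yAB : y \notin [:: c.-1; c].
  by rewrite !inE; move: o2; rewrite -/y /outer; case: (t) => /=; lia.
have mem_pt (x : 'I_N.+1) : (x \in [:: pt N c;
  pt N c.+1]) = (val x \in [:: c.-1; c]).
  by rewrite !inE -!val_eqE /= !inordK //; lia.
have posE p : odd_pos s p = (iter p.-1 (actn s) 0 \notin [:: c.-1; c]) &&
    (iter p (actn s) 0 \in [:: c.-1; c]).
  by rewrite /odd_pos mN /= !mem_pt /= !pt1X.
have [i iN iy] := orbit_onto fs yN.
have i1 : iter i.+1 (actn s) 0 = A by rewrite iterS iy.
have i2 : iter i.+2 (actn s) 0 = B by rewrite iterS i1.
have [A0 B0] : A <> 0 /\ B <> 0 by rewrite /A /B /letter; case: (t) => /=; lia.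
(* The notation starts with 0, which is neither A nor B because c > 1. So A and B both follow y
   before the notation closes up. *)
have iN1 : i < N.-1.
  have iN0 : i <> N by move=> e; case: A0; rewrite -i1 e.
  have iN2 : i.+1 <> N by move=> e; case: B0; rewrite -i2 e.
  lia.
have pE q : 0 < q <= N.-1 -> odd_pos s q -> q = i.+1.
  case: q => // q qN; rewrite posE /= -/(iter q.+1 (actn s) 0) => /andP[q1].
  have qN' : iter q (actn s) 0 < N.+1 by case: (q) => // r; exact: actn_lt.
  rewrite AB iterS => /orP[] /eqP e.
    have : q = i by apply: (orbit_inj fs) => //; [lia|rewrite iy;
      apply: (@actn_inj _ s _ _ qN' yN); rewrite e; exact: esym sy].
    by move->.
  have qA : iter q (actn s) 0 = A by apply: (@actn_inj _ s _ _ qN' AN);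
    rewrite e; exact: esym sA.
  by move: q1; rewrite qA AB eqxx.
rewrite mN; exists i.+1; split=> //; first by rewrite posE i1 /= iy yAB AB eqxx.
have bE b l : l < c -> bump c (letter c c b l) = letter c c.+1 b l.
  by clear -c2 => lc; rewrite /letter /bump; case: b; lia.
have bE0 b := bE b 0 (ltnW c2).
have rE t' : map (bump c) (ring c c t' 1 cs) = ring c c.+1 t' 1 cs.
  apply: (map_bump_ring (i := 0)) => b l _ lc; apply: bE.
  by move: lc jc; clear; lia.
have sr : (size (ring c c t 1 cs)).+1 = N.
  by rewrite size_ring; move: sz Nc; clear; lia.
have ne : (c == c.+1) = false by apply/eqP; clear; lia.
have [kN k1 k2 k3] : [/\ 1 < c.+1 <= N.+2, 0 < i.+1 <= N.+1,
    0 < i.+2 <= N.+1 & 0 < i.+3 <= N.+1].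
  by move: iN1 c2 Nc; clear; split; lia.
rewrite /word /core ne; case.
- rewrite addn1 /=.
  have := @ins_fcycle _ s c.+1 i.+2 (B :: ring c c t 1 cs) A fs kN k2 sr.
  rewrite -rot1_cons rot_cycle => /(_ fc i1).
  by rewrite rot1_cons /= map_rcons /= rE !bE0 negbK cats1.
- rewrite addn2 /=.
  have := @ins_fcycle _ s c.+1 i.+3 (ring c c t 1 cs ++ [:: A]) B fs kN k3.
  rewrite size_cat addn1 => /(_ sr).
  rewrite -cats1 -catA fcycle_catC => /(_ fc i2).
  by rewrite map_cat /= rE !bE0.
- rewrite addn0 /=.
  have := @ins_fcycle _ s c.+1 i.+1 (A :: B :: belast y1 Y) y fs kN k1.
  rewrite !rcons_cons -lastI -E => H.
  have sv : size [:: A, B & belast y1 Y] = N.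
    by move: sr; rewrite E /= size_belast.
  by move: (H sv fc iy); rewrite /= rE !bE0.
Qed.

End Odd.

(** * Bijectivity *)

Lemma nestedE N c h (s : 'S_N.+1) : N.+1./2 = c -> uphalf N.+1 = h ->
  nested s <-> exists t cs, size cs + (c == h) = c /\ fcycle (actn s) (word c h
    t cs).
Proof. by move=> <- <-. Qed.

Lemma psi_even_word N c (s : 'S_N.+1) t cs : N.+1 = c + c.+1 -> 0 < c ->
  size cs = c -> fcycle (actn s) (word c c.+1 t cs) ->
  exists p, [/\ 0 < p <= N.+1, even_pos s p,
    forall q, 0 < q <= N.+1 -> even_pos s q -> q = p,
    psi_even s = ins N.+2./2.+1 p s &
    fcycle (actn (psi_even s)) (word c.+1 c.+1 t cs)].
Proof.
move=> Nc c1 sz fc; have [p [pN pp up fi]] := even_fcycle Nc c1 sz fc.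
have e : the_in 1 N.+1 (even_pos s) = p by apply: the_in_unique.
by exists p; rewrite /psi_even e.
Qed.

Lemma psi_odd_word N c (s : 'S_N.+1) t cs : N.+1 = c + c -> 1 < c ->
  size cs + 1 = c -> fcycle (actn s) (word c c t cs) ->
  exists p, [/\ 0 < p <= N.-1, odd_pos s p,
    forall q, 0 < q <= N.-1 -> odd_pos s q -> q = p,
    forall q : 'I_3, psi_odd (s, q) = ins N.+3./2 (p + q) s &
    forall m (q : 'I_3), q = gap m :> nat ->
      fcycle (actn (psi_odd (s, q))) (word c c.+1 (flip m t) (m :: cs))].
Proof.
move=> Nc c1 sz fc; have [p [pN pp up fi]] := odd_fcycle Nc c1 sz fc.
have e : the_in 1 N.-1 (odd_pos s) = p by apply: the_in_unique.
exists p; rewrite /psi_odd /=; split=> //; first by rewrite e.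
by move=> m q qm; rewrite e qm.
Qed.

(* n = N.+2; the first part of each case says that p is well defined. *)
Theorem theorem4p21 (N : nat) (n_ge4 : 4 <= N.+2) :
  (~~ odd N.+2 ->
    (forall s : 'S_N.+1, s \in Sigma N.+1 ->
       exists! p : nat, (1 <= p <= N.+1) && even_pos s p)
    /\ bijective_from_to (Sigma N.+1) (Sigma N.+2) (@psi_even N))
  /\
  (odd N.+2 ->
    (forall s : 'S_N.+1, s \in Sigma N.+1 ->
       exists! p : nat, (1 <= p <= N.-1) && odd_pos s p)
    /\ bijective_from_to (setX (Sigma N.+1) [set: 'I_3]) (Sigma N.+2)
         (@psi_odd N)).
Proof.
have N2 : 1 < N by [].
have N3 : 1 < N.+1 by lia.
split=> oddN.
- pose c := N.+1./2; have Nc : N.+1 = c + c.+1 by rewrite /c; lia.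
  have c1 : 0 < c by rewrite /c; lia.
  have ne : (c == c.+1) = false by lia.
  have E1 (s : 'S_N.+1) : s \in Sigma N.+1 <->
      exists t cs, size cs = c /\ fcycle (actn s) (word c c.+1 t cs).
    rewrite -(rwP (SigmaP N2 s)) (@nestedE _ c c.+1) ?ne //;
      last by rewrite /c; lia.
    by split=> -[t [cs [sz fc]]]; exists t, cs; split=> //; lia.
  have E2 (s : 'S_N.+2) : s \in Sigma N.+2 <->
      exists t cs, size cs = c /\ fcycle (actn s) (word c.+1 c.+1 t cs).
    rewrite -(rwP (SigmaP N3 s)) (@nestedE _ c.+1 c.+1) ?eqxx //;
      try by rewrite /c; lia.
    by split=> -[t [cs [sz fc]]]; exists t, cs; split=> //; lia.
  split; last split.
  + move=> s /E1[t [cs [sz fc]]].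
    have [p [pN pp up _ _]] := psi_even_word Nc c1 sz fc.
    by exists p; split; [rewrite pN pp|move=> q /andP[qN /(up _ qN)]].
  + move=> s s' sS s'S; have fs := nested_full N2 (elimT (SigmaP N2 s) sS).
    have fs' := nested_full N2 (elimT (SigmaP N2 s') s'S).
    case/E1: sS => t [cs [sz fc]]; case/E1: s'S => t' [cs' [sz' fc']].
    have [p [pN _ _ -> _]] := psi_even_word Nc c1 sz fc.
    have [p' [p'N _ _ -> _]] := psi_even_word Nc c1 sz' fc'.
    have kN : 1 < N.+2./2.+1 <= N.+2 by lia.
    by case/(ins_inj fs fs' kN pN p'N).
  apply/setP => w; apply/imsetP/idP.
    case=> s /E1[t [cs [sz fc]]] ->; apply/E2; exists t, cs; split=> //.
    by have [p []] := psi_even_word Nc c1 sz fc.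
  case/E2 => t [cs [sz fw]].
  (* The preimage is given by the same type and moves, with the middle letter as core. *)
  have pw : perm_eq (word c c.+1 t cs) (iota 0 N.+1).
    by rewrite Nc; apply: word_perm; rewrite ?ne //; lia.
  have [s fs] := ex_fcycle_actn pw.
  exists s; first by apply/E1; exists t, cs.
  have [p [_ _ _ _ fp]] := psi_even_word Nc c1 sz fs.
  apply: fcycle_actn_inj fw fp.
  rewrite (_ : N.+2 = c.+1 + c.+1); last by lia.
  by apply: word_perm; rewrite ?eqxx //; lia.
pose c := N.+1./2; have Nc : N.+1 = c + c by rewrite /c; lia.
have c1 : 1 < c by rewrite /c; lia.
have ne : (c == c.+1) = false by lia.
have E1 (s : 'S_N.+1) : s \in Sigma N.+1 <->
    exists t cs, size cs + 1 = c /\ fcycle (actn s) (word c c t cs).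
  by rewrite -(rwP (SigmaP N2 s)) (@nestedE _ c c) ?eqxx //; rewrite /c; lia.
have E2 (s : 'S_N.+2) : s \in Sigma N.+2 <->
    exists t cs, size cs = c /\ fcycle (actn s) (word c c.+1 t cs).
  rewrite -(rwP (SigmaP N3 s)) (@nestedE _ c c.+1) ?ne //; try by rewrite /c;
    lia.
  by split=> -[t [cs [sz fc]]]; exists t, cs; split=> //; lia.
split; last split.
- move=> s /E1[t [cs [sz fc]]].
  have [p [pN pp up _ _]] := psi_odd_word Nc c1 sz fc.
  by exists p; split; [rewrite pN pp|move=> q /andP[qN /(up _ qN)]].
- move=> [s q] [s' q']; rewrite !in_setX !in_setT !andbT /= => sS s'S.
  have fs := nested_full N2 (elimT (SigmaP N2 s) sS).
  have fs' := nested_full N2 (elimT (SigmaP N2 s') s'S).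
  case/E1: sS => t [cs [sz fc]]; case/E1: s'S => t' [cs' [sz' fc']].
  have [p [pN pp _ -> _]] := psi_odd_word Nc c1 sz fc.
  have [p' [p'N _ up' -> _]] := psi_odd_word Nc c1 sz' fc'.
  have [q3 q'3] := (ltn_ord q, ltn_ord q').
  have kN : 1 < N.+3./2 <= N.+2 by lia.
  have pqN : 0 < p + q <= N.+1 by lia.
  have pqN' : 0 < p' + q' <= N.+1 by lia.
  case/(ins_inj fs fs' kN pqN pqN') => epq es.
  (* Once the permutations agree, uniqueness of the position gives p = p', and then [epq] yields q =
     q'. *)
  rewrite es in pp *; rewrite -(up' _ pN pp) in epq.
  by congr (_, _); apply: val_inj => /=; lia.
apply/setP => w; apply/imsetP/idP.
  case=> -[s q]; rewrite in_setX in_setT andbT => /E1[t [cs [sz fc]]] ->.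
  have [p [_ _ _ _ fp]] := psi_odd_word Nc c1 sz fc.
  have [m qm] : exists m, q = gap m :> nat.
    by case: q => -[|[|[|//]]] ?; [exists Rgt|exists Alt|exists Lft].
  apply/E2; exists (flip m t), (m :: cs); split; [by rewrite /=; lia|exact: fp].
case/E2 => t [[|m cs] [sz fw]]; first by move: sz => /=; lia.
have szc : size cs + 1 = c by move: sz => /=; lia.
(* The first move is dropped and becomes the choice of q. The preimage has type [flip m t], because
   [flip m] is an involution. *)
have pw : perm_eq (word c c (flip m t) cs) (iota 0 N.+1).
  by rewrite Nc; apply: word_perm; rewrite ?eqxx //; lia.
have [s fs] := ex_fcycle_actn pw.
have [p [_ _ _ _ fp]] := psi_odd_word Nc c1 szc fs.
have m3 : gap m < 3 by case: (m).
exists (s, Ordinal m3).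
  by rewrite in_setX in_setT andbT; apply/E1; exists (flip m t), cs.
have := fp m (Ordinal m3) erefl.
rewrite (_ : flip m (flip m t) = t); last by case: (m) => //=; rewrite negbK.
apply: fcycle_actn_inj fw.
rewrite (_ : N.+2 = c + c.+1); last by lia.
by apply: word_perm; rewrite ?ne //; lia.
Qed.
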